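(* Every $C_4C_8$ system is a partial cube.
   Context: The infinite $C_4C_8$ net $\mathcal{H}$ is the infinite plane graph formed by the vertices and edges of the tiling of the plane by regular octagons and squares (the truncated square tiling, in which every vertex has degree 3 and lies on one square and two octagons). For a cycle $Z$ of $\mathcal{H}$, the $C_4C_8$ system determined by $Z$ is the subgraph of $\mathcal{H}$ consisting of the vertices and edges lying on $Z$ or in the interior of $Z$. A partial cube is a graph isomorphic to an isometric (distance-preserving) subgraph of a hypercube $Q_n$ (vertex set $\{0,1\}^n$, two vertices adjacent iff they differ in exactly one coordinate). *)

(* Defs.v *)
From HB Require Import structures.
From mathcomp Require Import all_boot all_order all_algebra.
From mathcomp Require Import all_classical all_reals all_analysis.
Set Implicit Arguments.
Unset Strict Implicit.
Unset Printing Implicit Defensive.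
Import Order.TTheory GRing.Theory Num.Theory.
Import numFieldNormedType.Exports.
Local Open Scope classical_set_scope.
Local Open Scope ring_scope.

(* A simple graph whose vertices form a subset of an ambient type T. *)
Record graph (T : Type) := Graph {
  vert : set T;
  edge : T -> T -> Prop;
  edge_sym : forall u v, edge u v -> edge v u;
  edge_irrefl : forall u, ~ edge u u;
  edge_vert : forall u v, edge u v -> vert u }.

Inductive walk (T : Type) (G : graph T) : nat -> T -> T -> Prop :=
| walk_nil u : vert G u -> walk G 0 u u
| walk_cons k u v w : edge G u v -> walk G k v w -> walk G k.+1 u w.

Definition is_dist (T : Type) (G : graph T) (u v : T) (d : nat) : Prop :=
  walk G d u v /\ forall k, walk G k u v -> (d <= k)%N.

Definition subgraph (T : Type) (H G : graph T) : Prop :=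
  vert H `<=` vert G /\ forall u v, edge H u v -> edge G u v.

Definition isometric_subgraph (T : Type) (H G : graph T) : Prop :=
  subgraph H G /\
  forall u v, vert H u -> vert H v -> forall d, is_dist H u v d <-> is_dist G u v d.

Definition isomorphic (T U : Type) (G : graph T) (H : graph U) : Prop :=
  exists2 f : T -> U, set_bij (vert G) (vert H) f &
    forall u v, vert G u -> vert G v -> (edge G u v <-> edge H (f u) (f v)).

Section Hypercube.
Variable n : nat.
Implicit Types x y : {ffun 'I_n -> bool}.

Definition cube_edge x y : Prop := #|[pred i | x i != y i]| = 1%N.

Lemma cube_edge_sym x y : cube_edge x y -> cube_edge y x.
Proof.
by rewrite /cube_edge => <-; apply: eq_card => i; rewrite !inE eq_sym.
Qed.

Lemma cube_edge_irrefl x : ~ cube_edge x x.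
Proof. by rewrite /cube_edge eq_card0// => i; rewrite !inE eqxx. Qed.

Definition hypercube : graph {ffun 'I_n -> bool} :=
  @Graph _ setT cube_edge cube_edge_sym cube_edge_irrefl (fun _ _ _ => I).

End Hypercube.

Definition partial_cube (T : Type) (G : graph T) : Prop :=
  exists n, exists2 H : graph {ffun 'I_n -> bool},
    isometric_subgraph H (hypercube n) & isomorphic G H.

(* The squares of the tiling are indexed by int * int and stand on a corner.  *)
(* The node (c, (a, s)) is a corner of the square c: the one on its           *)
(* horizontal (a = false) or vertical (a = true) diagonal, on the positive    *)
(* (s = true) or negative (s = false) side of the centre.                     *)
Definition node : Type := ((int * int) * (bool * bool))%type.

Definition square_edge (u v : node) : bool :=
  (u.1 == v.1) && (u.2.1 != v.2.1).

Definition axis_unit (a : bool) : int * int := if a then (0, 1) else (1, 0).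

(* The edges shared by two octagons join consecutive squares of a row or of a *)
(* column.                                                                    *)
Definition link (u v : node) : bool :=
  [&& u.2.1 == v.2.1, u.2.2, ~~ v.2.2 & v.1 == u.1 + axis_unit u.2.1].

Definition net_edge (u v : node) : bool :=
  [|| square_edge u v, link u v | link v u].

Lemma net_edge_sym u v : net_edge u v -> net_edge v u.
Proof.
by rewrite /net_edge /square_edge eq_sym [u.2.1 == _]eq_sym [link v u || _]orbC.
Qed.

Lemma net_edge_irrefl u : ~ net_edge u u.
Proof.
by rewrite /net_edge /square_edge /link !eqxx /=; case: u => c [a []].
Qed.

Definition C4C8_net : graph node :=
  @Graph _ setT net_edge net_edge_sym net_edge_irrefl (fun _ _ _ => I).

Definition net_cycle (z : seq node) : Prop := ucycle net_edge z /\ (2 < size z)%N.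

Definition cycle_edge (z : seq node) (u v : node) : bool :=
  ((u \in z) && (v == next z u)) || ((v \in z) && (u == next z v)).

Section System.
Variable R : realType.

(* With side length sqrt 2, the half-diagonal of a square is 1 and the        *)
(* centres of neighbouring squares are at distance 1 + sqrt 2 + 1.            *)
Definition period : R := 2 + Num.sqrt 2.

Definition pos (u : node) : R * R :=
  let: ((i, j), (a, s)) := u in
  let e : R := if s then 1 else -1 in
  (period * i%:~R + (if a then 0 else e), period * j%:~R + (if a then e else 0)).

Definition segment (p q : R * R) : set (R * R) :=
  [set (1 - t) *: p + t *: q | t in [set t : R | 0 <= t <= 1]].

Definition open_segment (p q : R * R) : set (R * R) :=
  [set (1 - t) *: p + t *: q | t in [set t : R | 0 < t < 1]].

Definition curve (z : seq node) : set (R * R) :=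
  [set p | exists2 u, u \in z & segment (pos u) (pos (next z u)) p].

(* The bounded component of the complement of the closed curve. *)
Definition cycle_interior (z : seq node) : set (R * R) :=
  [set p | (~` curve z) p /\ bounded_set (connected_component (~` curve z) p)].

Variable z : seq node.

Definition system_vert : set node :=
  [set u | u \in z \/ cycle_interior z (pos u)].

(* An edge is in the interior of z when the corresponding open segment is:    *)
(* its ends may lie on z.                                                     *)
Definition system_edge (u v : node) : Prop :=
  [/\ net_edge u v, system_vert u, system_vert v &
      cycle_edge z u v \/ open_segment (pos u) (pos v) `<=` cycle_interior z].

Lemma open_segmentC p q : open_segment p q `<=` open_segment q p.
Proof.
move=> _ [t /andP[t0 t1] <-]; exists (1 - t) => /=.
  by rewrite subr_gt0 t1 ltrBlDr ltrDl.
by rewrite subKr addrC.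
Qed.

Lemma system_edge_sym u v : system_edge u v -> system_edge v u.
Proof.
case=> /net_edge_sym uv su sv h; split=> //; case: h => [h|h].
  by left; rewrite /cycle_edge orbC.
by right; apply: subset_trans h; exact: open_segmentC.
Qed.

Lemma system_edge_irrefl u : ~ system_edge u u.
Proof. by case=> /net_edge_irrefl. Qed.

Lemma system_edge_vert u v : system_edge u v -> system_vert u.
Proof. by case. Qed.

Definition C4C8_system : graph node :=
  Graph system_edge_sym system_edge_irrefl system_edge_vert.

Lemma C4C8_system_subgraph : subgraph C4C8_system C4C8_net.
Proof. by split=> // u v []. Qed.

End System.

(* Main.v *)
Require Import Defs.
From mathcomp Require Import all_boot all_order all_algebra.
From mathcomp Require Import all_classical all_reals all_analysis.
From mathcomp Require Import zify ring lra.

(* Every edge of the net is crossed at its midpoint by exactly one of the     *)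
(* lines x = (i + 1/2) p, y = (j + 1/2) p, x - y = k p, x + y = k p (p the    *)
(* period), and such a line leaves a face through the side opposite to the    *)
(* one it came in by. Cut every line where it leaves the system: the edges    *)
(* crossed by one piece form a class, and the coordinates of the embedding    *)
(* are the classes.                                                           *)
(*   Parity: two walks with the same ends bound, mod 2, a finite set of       *)
(* faces. A bounded union of faces whose frontier lies in the curve is made   *)
(* of components of its complement, so all these faces are inner; each of     *)
(* them meets a class in 0 or 2 edges, hence the two walks cross every class  *)
(* the same number of times mod 2. The Jordan curve theorem is not needed.    *)
(*   Geodesics: suppose a walk crosses a class twice, with the stretch P      *)
(* between these crossings avoiding it. P has the ends of a path B along one  *)
(* side of the strip of faces met by the class; the lines crossed by B are    *)
(* distinct because two lines meet once, so by parity P is at least as long   *)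
(* as B. The path on the other side of the strip, of the same length as B,    *)
(* then shortcuts the walk by two. So geodesics cross every class at most     *)
(* once, and distances are Hamming distances.                                 *)

Set Implicit Arguments.
Unset Strict Implicit.
Unset Printing Implicit Defensive.
Import Order.TTheory GRing.Theory Num.Theory.
Import numFieldNormedType.Exports.
Local Open Scope classical_set_scope.

(** The graph theory is [partial_cube_criterion]: a connected graph with finitely many edge labels
    is a partial cube if the parity of each label on a walk depends only on the ends of the walk,
    and any walk that uses a label twice can be shortened. Parities then serve as coordinates, and a
    walk without repeated label is as long as the Hamming distance of its ends. For a system the
    labels are the pieces of cut lines ([edge_class]). Parity rests on a mod-2 winding number,
    [enclosed], which jumps exactly at the edges used an odd number of times ([enclosed_boundary]).
    Summed along a piece, the jumps cancel, because the faces at both ends of the piece are not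
    inner ([class_parity]). That enclosed faces are inner is the only topological input; it comes
    from [face_set_inner]. Shortening is [class_label_detours]: a strip of faces has two sides of
    equal length, and by parity no walk between the ends of a side is shorter than it. *)

(** * Partial cubes from labellings of edges *)

Section PartialCubeCriterion.
Variables (T : choiceType) (K : eqType) (G : graph T) (lab : T -> T -> K).

Definition adj (u v : T) : bool := `[< edge G u v >].
Definition labels (u : T) (p : seq T) : seq K := pairmap lab u p.

Lemma labels_cat u p q :
  labels u (p ++ q) = labels u p ++ labels (last u p) q.
Proof. exact: pairmap_cat. Qed.

Lemma adj_vert u v : adj u v -> vert G u /\ vert G v.
Proof.
by move=> /asboolP uv; split; [exact: edge_vert uv|exact: edge_vert (edge_sym uv)].
Qed.

Lemma path_vert_last u p : vert G u -> path adj u p -> vert G (last u p).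
Proof.
by elim: p u => //= v p IH u _ /andP[/adj_vert[_ Gv]] /(IH _ Gv).
Qed.

Lemma walk_path k u v :
  walk G k u v <->
  vert G u /\ exists p, [/\ path adj u p, last u p = v & size p = k].
Proof.
split=> [|[Gu [p [pth <- <-]]]].
  elim=> [x Gx|l x y t xy _ [_ [p [pth lst sz]]]].
    by split=> //; exists [::].
  split; first exact: edge_vert xy.
  by exists (y :: p); rewrite /= pth lst sz; split=> //; rewrite andbT; apply/asboolP.
elim: p u Gu pth => [|x p IH] u Gu /=; first by constructor.
move=> /andP[ux pth]; have [_ Gx] := adj_vert ux.
by apply: (@walk_cons _ G _ u x); [exact/asboolP|exact: IH].
Qed.

Lemma rev_path_labels (lab_sym : forall u v, adj u v -> lab u v = lab v u) u p :
  path adj u p ->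
  exists q, [/\ path adj (last u p) q, last (last u p) q = u &
    labels (last u p) q = rev (labels u p)].
Proof.
elim: p u => [|v p IH] u /=; first by exists [::].
move=> /andP[uv /IH[q [pth lst lbl]]]; exists (rcons q u).
have vu : adj v u by apply/asboolP/edge_sym/asboolP.
rewrite rcons_path pth lst last_rcons; split=> //.
by rewrite -cats1 labels_cat lst /= lbl rev_cons cats1 lab_sym.
Qed.

Lemma labels_split k u p : k \in labels u p ->
  exists q v r, [/\ p = q ++ v :: r, k \notin labels u q & lab (last u q) v = k].
Proof.
elim: p u => [|v p IH] u //=; rewrite inE.
have [-> _|neq /= /IH[q [w [r [-> kq lst]]]]] := eqVneq k (lab u v).
  by exists [::], v, p.
by exists (v :: q), w, r; rewrite /= inE negb_or neq kq.
Qed.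

Definition detours_shorten := forall u v p w,
  path adj u (v :: rcons p w) -> lab u v = lab (last v p) w ->
  lab u v \notin labels v p ->
  exists q, [/\ path adj u q, last u q = w & (size q < (size p).+2)%N].

(** If the label of the first edge recurs, its first recurrence closes a detour that the hypothesis
    shortens; otherwise the repetition lies in the tail. *)
Lemma repeated_label_shorten : detours_shorten -> forall u p,
  path adj u p -> ~~ uniq (labels u p) ->
  exists q, [/\ path adj u q, last u q = last u p & (size q < size p)%N].
Proof.
move=> short u p; elim: p u => [//|v p IH] u /= /andP[uv pth].
rewrite negb_and negbK => /orP[/labels_split[q [w [r [eqp nin lst]]]]|nu].
  move: pth; rewrite eqp cat_path /= => /and3P[pq qw wr].
  have := short u v q w; rewrite /= uv rcons_path pq qw lst.
  move=> /(_ isT (erefl _) nin)[s [ps ls ss]]; exists (s ++ r).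
  rewrite cat_path ps ls wr !last_cat ls /= !size_cat /=; split=> //.
  by lia.
have [q [pq lq sq]] := IH v pth nu.
by exists (v :: q); rewrite /= uv pq lq.
Qed.

Lemma geodesic_exists u v p : detours_shorten ->
  path adj u p -> last u p = v ->
  exists q, [/\ path adj u q, last u q = v & uniq (labels u q)].
Proof.
move=> short; have [n] := ubnP (size p).
elim: n p => // n IH p szp pth lst.
have [un|nun] := boolP (uniq (labels u p)); first by exists p.
have [q [pq lq sq]] := repeated_label_shorten short pth nun.
by apply: (IH q) => //; [lia|rewrite lq].
Qed.

Definition parity_invariant := forall u p q, vert G u ->
  path adj u p -> path adj u q -> last u p = last u q ->
  forall k, odd (count_mem k (labels u p)) = odd (count_mem k (labels u q)).


Definition hamming n (x y : {ffun 'I_n -> bool}) := #|[pred i | x i != y i]|.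

Lemma hamming_triangle n (x y w : {ffun 'I_n -> bool}) :
  (hamming x w <= hamming x y + hamming y w)%N.
Proof.
rewrite /hamming -[X in (X <= _)%N]cardsE -[X in (_ <= X + _)%N]cardsE.
rewrite -[X in (_ <= _ + X)%N]cardsE.
apply: leq_trans (leq_card_setU _ _).1; apply/subset_leq_card/fintype.subsetP => i.
by rewrite !inE; case: (x i); case: (y i); case: (w i).
Qed.

Lemma walk_hamming n k (x y : {ffun 'I_n -> bool}) :
  walk (hypercube n) k x y -> (hamming x y <= k)%N.
Proof.
elim=> {k x y} [x _|k x y w xy _ IH].
  by rewrite /hamming eq_card0// => i; rewrite !inE eqxx.
by apply: leq_trans (hamming_triangle x y w) _; rewrite /hamming xy add1n ltnS.
Qed.

Lemma walk_sub (S : Type) (H H' : graph S) k x y :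
  subgraph H H' -> walk H k x y -> walk H' k x y.
Proof.
move=> [HV HE]; elim=> {k x y} [x Hx|k x y w xy _ IH].
  by constructor; exact: HV.
by apply: (@walk_cons _ _ _ x y) => //; exact: HE.
Qed.

Variables (v0 : T) (ks : seq K).
Hypothesis Gv0 : vert G v0.
Hypothesis conn : forall u v, vert G u -> vert G v ->
  exists p, path adj u p /\ last u p = v.
Hypothesis ks_uniq : uniq ks.
Hypothesis ks_lab : forall u v, adj u v -> lab u v \in ks.
Hypothesis inv : parity_invariant.
Hypothesis short : detours_shorten.

Let n := size ks.

Definition base_path (u : T) : seq T :=
  xget [::] [set p | path adj v0 p /\ last v0 p = u].

Lemma base_pathP u : vert G u ->
  path adj v0 (base_path u) /\ last v0 (base_path u) = u.
Proof.
move=> Gu; have [p pP] := conn Gv0 Gu.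
rewrite /base_path; case: xgetP => [q -> //|/(_ p)]; by case.
Qed.

(** By [parity_invariant] the values do not depend on the chosen walk. *)
Definition coords (u : T) : {ffun 'I_n -> bool} :=
  [ffun i => odd (count_mem (tnth (in_tuple ks) i) (labels v0 (base_path u)))].

Lemma coordsP u q i : vert G u -> path adj u q ->
  coords u i (+) coords (last u q) i =
  odd (count_mem (tnth (in_tuple ks) i) (labels u q)).
Proof.
move=> Gu pq; have Gv := path_vert_last Gu pq.
have [pu lu] := base_pathP Gu; have [pv lv] := base_pathP Gv.
rewrite !ffunE -(@inv v0 (base_path u ++ q) (base_path (last u q))) //.
- by rewrite labels_cat lu count_cat oddD addbA addbb.
- by rewrite cat_path pu lu.
- by rewrite last_cat lu lv.
Qed.

Lemma labels_sub u q : path adj u q -> {subset labels u q <= ks}.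
Proof.
elim: q u => [|v q IH] u //= /andP[uv pq] k; rewrite inE => /predU1P[->|].
  exact: ks_lab.
exact: IH.
Qed.

Lemma hamming_coords u q : vert G u -> path adj u q -> uniq (labels u q) ->
  hamming (coords u) (coords (last u q)) = size q.
Proof.
move=> Gu pq uq; have -> : size q = size (labels u q) by rewrite size_pairmap.
(* The labels are distinct, so listing them in the order of [ks] turns the length into a number of
   indices; by [coordsP] these are the indices where the coordinates differ. *)
have /perm_size -> : perm_eq (labels u q) [seq k <- ks | k \in labels u q].
  apply: uniq_perm; rewrite ?filter_uniq // => k; rewrite mem_filter.
  by case: (boolP (k \in _)) => // /(labels_sub pq) ->.
rewrite size_filter -sum1_count big_tnth sum1_card /hamming.
apply: eq_card => i; have := coordsP i Gu pq.
rewrite count_uniq_mem // oddb => lab_i.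
transitivity (tnth (in_tuple ks) i \in labels u q); last by [].
by rewrite -lab_i inE; case: (coords u i); case: (coords _ i).
Qed.

Lemma coords_geodesic u v : vert G u -> vert G v ->
  walk G (hamming (coords u) (coords v)) u v.
Proof.
move=> Gu Gv; have [p [pp lp]] := conn Gu Gv.
have [q [pq lq uq]] := geodesic_exists short pp lp.
apply/walk_path; split=> //; exists q; split=> //.
by rewrite -lq hamming_coords.
Qed.

Lemma coords_edge u v : edge G u v -> cube_edge (coords u) (coords v).
Proof.
move=> uv; have := @hamming_coords u [:: v]; rewrite /= andbT.
by apply=> //; [exact: edge_vert uv|exact/asboolP].
Qed.

Lemma coords_inj : {in vert G &, injective coords}.
Proof.
move=> u v /set_mem Gu /set_mem Gv uv; have := coords_geodesic Gu Gv.
rewrite uv (_ : hamming _ _ = 0%N); first by move=> w; inversion w.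
by rewrite /hamming eq_card0// => i; rewrite !inE eqxx.
Qed.

Let image_edge x y := exists u v, [/\ edge G u v, coords u = x & coords v = y].

Let image_edge_sym x y : image_edge x y -> image_edge y x.
Proof. by move=> [u [v [uv <- <-]]]; exists v, u; split=> //; exact: edge_sym. Qed.

Let image_edge_irrefl x : ~ image_edge x x.
Proof.
by move=> [u [v [uv <- eqv]]]; have := coords_edge uv; rewrite eqv => /cube_edge_irrefl.
Qed.

Let image_edge_vert x y : image_edge x y -> (coords @` vert G) x.
Proof. by move=> [u [v [uv <- _]]]; exists u => //; exact: edge_vert uv. Qed.

Let image_graph := Graph image_edge_sym image_edge_irrefl image_edge_vert.

(** The walk of [coords_geodesic] maps to one in the image whose length is the Hamming distance, a
    lower bound for walks in the whole cube; so both distances equal it. *)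
Lemma partial_cube_criterion : partial_cube G.
Proof.
have sub : subgraph image_graph (hypercube n).
  by split=> // _ _ [u [v [uv <- <-]]]; exact: coords_edge.
have image_walk k u v : walk G k u v -> walk image_graph k (coords u) (coords v).
  elim=> [x Gx|l x y t xy _ IH]; first by constructor; exists x.
  by apply: (@walk_cons _ _ _ _ (coords y)) => //; exists x, y.
exists n, image_graph.
  split=> // _ _ [u Gu <-] [v Gv <-] d.
  have wH := image_walk _ _ _ (coords_geodesic Gu Gv).
  have wQ := walk_sub sub wH.
  split=> [[wd dmin]|[wd dmin]].
    split=> [|k /walk_hamming]; first exact: walk_sub wd.
    exact: leq_trans (dmin _ wH).
  have dE : d = hamming (coords u) (coords v).
    by apply/eqP; rewrite eqn_leq (walk_hamming wd) (dmin _ wQ).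
  rewrite dE; split=> // k /(walk_sub sub); exact: walk_hamming.
exists coords.
  split=> [x Gx||x [u Gu <-]]; [by exists x|exact: coords_inj|by exists u].
move=> u v Gu Gv; split=> [uv|[a [b [ab /coords_inj eqa /coords_inj eqb]]]].
  by exists u, v.
have [Ga Gb] : vert G a /\ vert G b by apply/adj_vert/asboolP.
by rewrite -eqa ?inE// -eqb ?inE.
Qed.

End PartialCubeCriterion.

(** * Coordinates for the edges, faces and cut lines of the net *)

Local Open Scope ring_scope.

(* The line (d, o, k) is x = (k + 1/2) p, y = (k + 1/2) p, x - y = k p or      *)
(* x + y = k p when (d, o) is (false, false), (false, true), (true, false) or *)
(* (true, true). The edge (l, r) is the one crossed at position r on l. On    *)
(* the last two kinds of lines the positions 2 i and 2 i + 1 are the sides of *)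
(* a square in column i, which zig decodes.                                   *)
(* A face (true, c) is the square c; (false, c) is the octagon whose lower    *)
(* left neighbour is the square c.                                            *)
Definition line : Type := (bool * bool * int)%type.
Definition eid : Type := (line * int)%type.
Definition face : Type := (bool * (int * int))%type.

Definition zig (r : int) : int * bool := ((r %/ 2)%Z, (r %% 2)%Z == 1).

Lemma zigE i (o : bool) : zig (i * 2 + o%:Z) = (i, o).
Proof. by rewrite /zig; congr pair; case: o => /=; lia. Qed.

Lemma zigP r : exists i (o : bool), r = i * 2 + o%:Z.
Proof. by exists (zig r).1, (zig r).2; rewrite /zig /=; lia. Qed.

Lemma zigS i (o : bool) : i * 2 + o%:Z + 1 = (if o then i + 1 else i) * 2 + (~~ o)%:Z.
Proof. by case: o => /=; lia. Qed.

Lemma zigB i (o : bool) : i * 2 + o%:Z - 1 = (if o then i else i - 1) * 2 + (~~ o)%:Z.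
Proof. by case: o => /=; lia. Qed.

Opaque zig.

(** The boolean names a side of the cut line, the same for all edges of the line; hence the
    exclusive ors with the parity of the position. *)
Definition ends (e : eid) (b : bool) : node :=
  let: (d, o, k, r) := e in
  match d, o with
  | false, false => if b then ((k + 1, r), (false, false)) else ((k, r), (false, true))
  | false, true => if b then ((r, k + 1), (true, false)) else ((r, k), (true, true))
  | true, false => let: (i, t) := zig r in ((i, i - k), (~~ (b (+) t), t))
  | true, true => let: (i, t) := zig r in ((i, k - i), (b (+) t, b))
  end.

Definition eid_of (u v : node) : eid :=
  if u.2.1 == v.2.1 then
    let: ((i, j), (a, _)) := if u.2.2 then u else v in
    if a then ((false, true), j, i) else ((false, false), i, j)
  else
    let: (i, j) := u.1 in
    let: (s, t) := if u.2.1 then (v.2.2, u.2.2) else (u.2.2, v.2.2) in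
    ((true, s (+) t), if s (+) t then i + j else i - j, i * 2 + s%:Z).

(* The face met by l between the edges (l, r) and (l, r + 1). *)
Definition face_at (l : line) (r : int) : face :=
  let: (d, o, k) := l in
  match d, o with
  | false, false => (false, (k, r))
  | false, true => (false, (r, k))
  | true, false => let: (i, t) := zig r in (~~ t, (i, i - k))
  | true, true => let: (i, t) := zig r in (~~ t, (i, k - i - t%:Z))
  end.

Lemma linkE (u v : node) : link u v =
  [&& u.2.1 == v.2.1, u.2.2, ~~ v.2.2, v.1.1 == u.1.1 + (~~ u.2.1)%:Z &
      v.1.2 == u.1.2 + (u.2.1)%:Z].
Proof.
case: u v => [[i j] [a s]] [[i' j'] [a' s']]; rewrite /link /=.
by case: a => /=; rewrite -pair_eqE.
Qed.

Lemma net_edge_ends e b : net_edge (ends e b) (ends e (~~ b)).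
Proof.
case: e => [[[d o] k] r]; have [i [t ->]] := zigP r.
rewrite /net_edge !linkE /square_edge /ends zigE.
by case: d; case: o; case: b; case: t => /=; rewrite ?eqxx ?orbT //=; lia.
Qed.

Lemma eid_ofK u v : net_edge u v ->
  exists b, u = ends (eid_of u v) b /\ v = ends (eid_of u v) (~~ b).
Proof.
case: u v => [[i j] [a s]] [[i' j'] [a' s']].
rewrite /net_edge !linkE /square_edge /eid_of /ends /= -pair_eqE /=.
case: a; case: a' => //=; rewrite ?andbF ?andbT ?orbF //=.
- case: s; case: s' => //= /andP[/eqP ? /eqP ?]; [exists false|exists true];
    by split; congr (_, _, _); lia.
- move=> /andP[/eqP <- /eqP <-].
  by rewrite !zigE; case: s; case: s' => /=; (exists true + exists false);
    split; congr (_, _, _); lia.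
- move=> /andP[/eqP <- /eqP <-].
  by rewrite !zigE; case: s; case: s' => /=; (exists true + exists false);
    split; congr (_, _, _); lia.
- case: s; case: s' => //= /andP[/eqP ? /eqP ?]; [exists false|exists true];
    by split; congr (_, _, _); lia.
Qed.

Lemma ends_sym e b : eid_of (ends e b) (ends e (~~ b)) = e.
Proof.
case: e => [[[d o] k] r]; have [i [t ->]] := zigP r.
rewrite /eid_of /ends !zigE.
by case: d; case: o; case: b; case: t => //=; congr (_, _, _, _); lia.
Qed.

Lemma eid_ofC u v : net_edge u v -> eid_of u v = eid_of v u.
Proof.
move=> /eid_ofK[b [uE vE]]; have := ends_sym (eid_of u v) (~~ b).
by rewrite negbK -uE -vE.
Qed.

(** * Faces enclosed mod 2 by a closed walk *)

Definition eids (u : node) (p : seq node) : seq eid := pairmap eid_of u p.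

Lemma eids_cat u p q : eids u (p ++ q) = eids u p ++ eids (last u p) q.
Proof. exact: pairmap_cat. Qed.

Definition par (P : pred eid) (W : seq eid) : bool := odd (count P W).

Lemma par_xor P Q W : par P W (+) par Q W = par (fun e => P e (+) Q e) W.
Proof.
rewrite /par; elim: W => //= e W; rewrite !oddD !oddb => <-.
by case: (P e); case: (Q e); do 2 case: (odd _).
Qed.

(** The coboundary of [X] mod 2. *)
Definition cut (X : node -> bool) (e : eid) : bool :=
  X (ends e true) (+) X (ends e false).

Lemma cut_par X u p : path net_edge u p ->
  par (cut X) (eids u p) = X u (+) X (last u p).
Proof.
rewrite /par; elim: p u => [|v p IH] u /=; first by rewrite addbb.
move=> /andP[/eid_ofK[b [uE vE]] /IH]; rewrite oddD oddb => ->.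
have -> : cut X (eid_of u v) = X u (+) X v.
  by rewrite /cut; case: b uE vE => /= <- <- //; rewrite addbC.
by rewrite -addbA addKb.
Qed.

(* Mod-2 cycle: every cut is crossed an even number of times. *)
Definition balanced (W : seq eid) : Prop := forall X, par (cut X) W = false.

Lemma balanced_paths u p q : path net_edge u p -> path net_edge u q ->
  last u p = last u q -> balanced (eids u p ++ eids u q).
Proof.
move=> pp pq lst X; rewrite /par count_cat oddD -!/(par _ _).
by rewrite !cut_par // lst addbb.
Qed.

Definition right_of (i j : int) (e : eid) : bool :=
  (e.1 == (false, true, j)) && (i < e.2).

(** The north-east side of a square leads to the octagon of the same index; for a square, [enclosed]
    crosses it first and then follows the ray of that octagon. *)
Definition ne_edge (i j : int) : eid := ((true, false), i - j, i * 2 + 1).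

(* The parity of the crossings of W with the ray going right from the octagon. *)
Definition enclosed (W : seq eid) (f : face) : bool :=
  let: (q, (i, j)) := f in
  par (right_of i j) W (+) (q && par (pred1 (ne_edge i j)) W).

Lemma balanced_par (X : node -> bool) P W :
  balanced W -> P =1 cut X -> par P W = false.
Proof. by move=> bal PX; rewrite -(bal X) /par (eq_count PX). Qed.

Definition right_squares (i j : int) (u : node) := (u.1.2 == j) && (i < u.1.1).
Definition corner (i j : int) (a s : bool) (u : node) := u == ((i, j), (a, s)).

Ltac pointwise_cut :=
  let t := fresh in move=> [] [] ? ? t;
  rewrite /right_squares /corner /cut /right_of /ne_edge /= ?zigE ?xpair_eqE;
  case: t => /=; lia.

(** The rays of the two faces and the edge between them add up, mod 2, to the coboundary of the
    nodes they enclose, which a balanced [W] meets evenly. These nodes are a half-row of squares, a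
    few corners of one square, both, or none when one ray extends the other by the edge itself. *)
Lemma enclosed_boundary W l r : balanced W ->
  enclosed W (face_at l (r - 1)) (+) enclosed W (face_at l r) =
  par (pred1 (l, r)) W.
Proof.
move=> bal.
have addb_eq a b c : a (+) b (+) c = false -> a (+) b = c by case: a b c => [] [] [].
have check P X : (forall d o k (i : int) (t : bool),
    P (d, o, k, i * 2 + t%:Z) = cut X (d, o, k, i * 2 + t%:Z)) -> par P W = false.
  move=> PX; apply: (balanced_par bal) => -[[[d o] k'] r'].
  by have [i' [t' ->]] := zigP r'; exact: PX.
case: l => [[[] []] k]; have [i [t ->]] := zigP r;
  rewrite ?zigB /face_at ?zigE; apply: addb_eq; case: t;
  rewrite /enclosed /= ?addbF !par_xor.
- apply: (check _ (fun u => right_squares i (k - i) u || corner i (k - i) false true u)).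
  by pointwise_cut.
- by apply: (check _ (corner i (k - i) true true)); pointwise_cut.
- by apply: (check _ xpred0); pointwise_cut.
- apply: (check _ (fun u => [|| right_squares i (i - k) u, corner i (i - k) false true u |
                             corner i (i - k) true false u])).
  by pointwise_cut.
- by apply: (check _ xpred0); pointwise_cut.
- by apply: (check _ xpred0); pointwise_cut.
- by apply: (check _ (right_squares k (i * 2 + 1))); pointwise_cut.
- by apply: (check _ (right_squares k (i * 2))); pointwise_cut.
Qed.

Definition node_in (N : int) (u : node) : bool :=
  [&& - N <= u.1.1, u.1.1 <= N, - N <= u.1.2 & u.1.2 <= N].

Definition face_in (N : int) (f : face) : bool :=
  [&& - N <= f.2.1, f.2.1 <= N, - N <= f.2.2 & f.2.2 <= N].

Lemma par_mem P W : par P W -> exists2 e, e \in W & P e.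
Proof.
move=> PW; apply/hasP; rewrite has_count.
by move: PW; rewrite /par; case: count.
Qed.

Lemma enclosed_in W N f : balanced W ->
  (forall e, e \in W -> node_in N (ends e false)) ->
  enclosed W f -> face_in N f.
Proof.
case: f => q [i j] bal WN; rewrite /enclosed.
have [rW _|_ /=] := boolP (par (right_of i j) W); last first.
  move=> /andP[_ /par_mem[e /WN + /eqP eE]]; rewrite eE.
  by rewrite /node_in /face_in /= (zigE i true) /=; lia.
have [[[[d o] k] r] eW] := par_mem rW; rewrite /right_of !xpair_eqE /=.
move=> /andP[/andP[/andP[/eqP dE /eqP oE] /eqP kE] ir].
have := WN _ eW; rewrite dE oE kE /node_in /face_in /= => rN.
suff : - N <= i by lia.
(* A ray that starts west of the box meets every edge of [W] in its row, so on [W] it agrees with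
   the coboundary of a half-plane. *)
rewrite leNgt; apply/negP => iN; have := bal (fun u => u.1.2 <= j).
rewrite /par (@eq_in_count _ _ (right_of i j)) => [|e /WN].
  by rewrite -/(par _ _) rW.
case: e => [[[d' o'] k'] r']; rewrite /cut /right_of /node_in !xpair_eqE /=.
have [i' [t' ->]] := zigP r'; case: d'; case: o'; rewrite /= ?zigE /=; lia.
Qed.

(** * Incidence of lines and faces, and paths beside a cut line *)

Definition borders (f : face) (e : eid) : bool :=
  (face_at e.1 e.2 == f) || (face_at e.1 (e.2 - 1) == f).

(* The cut lines through the centre of a face. *)
Definition on_line (f : face) (l : line) : bool :=
  let: (q, (i, j)) := f in let: (d, o, k) := l in
  match d, o with
  | false, false => ~~ q && (k == i)
  | false, true => ~~ q && (k == j)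
  | true, false => k == i - j
  | true, true => k == i + j + (~~ q)%:Z
  end.

Lemma face_at_on_line l r : on_line (face_at l r) l.
Proof.
case: l => [[[] []] k]; have [i [t ->]] := zigP r;
  by rewrite /on_line /= ?zigE ?eqxx //; case: t => /=; lia.
Qed.

Lemma borders_on_line f e : borders f e -> on_line f e.1.
Proof. by case/orP => /eqP <-; exact: face_at_on_line. Qed.

(** Distinct lines have at most one common point, and a face is determined by its centre. *)
Lemma lines_cross_once f g l m : l != m ->
  on_line f l -> on_line f m -> on_line g l -> on_line g m -> f = g.
Proof.
case: f g l m => [q [i j]] [q' [i' j']] [[d o] k] [[d' o'] k'] lm h1 h2 h3 h4.
suff /and3P[/eqP -> /eqP -> /eqP ->] : [&& q == q', i == i' & j == j'] by [].
move: lm h1 h2 h3 h4; rewrite !xpair_eqE /=.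
by case: d; case: o; case: d'; case: o'; case: q; case: q' => /=; lia.
Qed.

Lemma face_at_inj l : injective (face_at l).
Proof.
case: l => [[[] []] k] r r'; have [i [t ->]] := zigP r; have [i' [t' ->]] := zigP r';
  rewrite /= ?zigE; case=> //; first [by move=> /negb_inj -> -> | by move=> -> ].
Qed.

(* One step along side b of l, around the face between (l, r) and (l, r + 1). *)
Definition up (l : line) (r : int) (b : bool) : seq node :=
  let: (d, o, k) := l in
  match d, o with
  | false, false => let i := if b then k + 1 else k in
    [:: ((i, r), (true, true)); ((i, r + 1), (true, false));
        ((i, r + 1), (false, ~~ b))]
  | false, true => let j := if b then k + 1 else k in
    [:: ((r, j), (false, true)); ((r + 1, j), (false, false));
        ((r + 1, j), (true, ~~ b))]
  | true, false => let: (i, t) := zig r in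
    if ~~ t then [:: ends (l, r + 1) b]
    else if b then
      [:: ((i, i - k + 1), (true, false)); ((i, i - k + 1), (false, true));
          ((i + 1, i - k + 1), (false, false))]
    else
      [:: ((i + 1, i - k), (false, false)); ((i + 1, i - k), (true, true));
          ((i + 1, i - k + 1), (true, false))]
  | true, true => let: (i, t) := zig r in
    if ~~ t then [:: ends (l, r + 1) b]
    else if b then
      [:: ((i + 1, k - i), (false, false)); ((i + 1, k - i), (true, false));
          ((i + 1, k - i - 1), (true, true))]
    else
      [:: ((i, k - i - 1), (true, true)); ((i, k - i - 1), (false, true));
          ((i + 1, k - i - 1), (false, false))]
  end.

Lemma up_path l r b : path net_edge (ends (l, r) b) (up l r b).
Proof.
case: l => [[[] []] k]; have [i [t ->]] := zigP r; rewrite /= ?zigE ?zigS ?zigE;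
  case: t; case: b; rewrite /= /net_edge !linkE /square_edge /= ?xpair_eqE ?andbT; lia.
Qed.

Lemma up_last l r b : last (ends (l, r) b) (up l r b) = ends (l, r + 1) b.
Proof.
case: l => [[[] []] k]; have [i [t ->]] := zigP r; rewrite /= ?zigE ?zigS ?zigE;
  by case: t; case: b => //=; congr (_, _, _); lia.
Qed.

(** The value is independent of [b], so the two sides of a strip of faces are equally long. *)
Lemma up_size l r b : size (up l r b) = (if (face_at l r).1 then 1 else 3)%N.
Proof.
case: l => [[[] []] k]; have [i [t ->]] := zigP r; rewrite /= ?zigE ?zigS ?zigE;
  by case: t; case: b.
Qed.

Lemma zig_simp i : (zig (i * 2 + Posz 0) = (i, false)) *
  (zig (i * 2 + Posz 1) = (i, true)) * (zig (i * 2 + Posz 0 - 1) = (i - 1, true)) *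
  (zig (i * 2 + Posz 1 - 1) = (i, false)).
Proof.
do !split; [exact: (zigE i false)|exact: (zigE i true)| |].
  by rewrite -(zigE (i - 1) true); congr zig; lia.
by rewrite -(zigE i false); congr zig; lia.
Qed.

Lemma up_borders l r b : all (borders (face_at l r)) (eids (ends (l, r) b) (up l r b)).
Proof.
case: l => [[[] []] k]; have [i [t ->]] := zigP r; rewrite /= ?zigE ?zigS ?zigE;
  case: t; case: b; rewrite /= /borders /= ?zig_simp /= ?xpair_eqE /=; lia.
Qed.

(** Within one face, the lines crossed are told apart from each other and from [l] by their
    directions. *)
Lemma up_kinds l r b :
  uniq (l.1 :: [seq e.1.1 | e <- eids (ends (l, r) b) (up l r b)]).
Proof.
case: l => [[[] []] k]; have [i [t ->]] := zigP r; rewrite /= ?zigE ?zigS ?zigE;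
  by case: t; case: b.
Qed.

Lemma int_interval_finite (N : int) :
  exists s : seq int, forall i : int, - N <= i <= N -> i \in s.
Proof.
exists [seq n%:Z - `|N| | n <- iota 0 (`|N| * 2).+1] => i iN.
by apply/mapP; exists (absz (i + `|N|)%R); [rewrite mem_iota|]; lia.
Qed.

Lemma int_square_finite (N : int) : exists s : seq (int * int),
  forall c, [&& - N <= c.1, c.1 <= N, - N <= c.2 & c.2 <= N] -> c \in s.
Proof.
have [s sP] := int_interval_finite N; exists [seq (i, j) | i <- s, j <- s].
by move=> [i j] /= ijN; apply: allpairs_f; apply: sP; lia.
Qed.

Lemma node_in_finite N : exists s : seq node, forall u, node_in N u -> u \in s.
Proof.
have [s sP] := int_square_finite N.
exists [seq (c, t) | c <- s,
  t <- [seq (a, b) | a <- [:: true; false], b <- [:: true; false]]].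
by move=> [c [a b]] /(sP c) cs; apply: allpairs_f => //; case: (a); case: (b).
Qed.

Lemma face_in_finite N : exists s : seq face, forall f, face_in N f -> f \in s.
Proof.
have [s sP] := int_square_finite N; exists [seq (q, c) | q <- [:: true; false], c <- s].
by move=> [q c] /(sP c) cs; apply: allpairs_f => //; case: (q).
Qed.

(** * Classes of edges crossed by one piece of a cut line *)

Section InnerFaces.
Variables (G : graph node) (inner : set face) (N : int).
Hypothesis G_net : forall u v, edge G u v -> net_edge u v.
Hypothesis inner_edge : forall f e b, inner f -> borders f e ->
  edge G (ends e b) (ends e (~~ b)).
Hypothesis inner_in : forall f, inner f -> face_in N f.
Hypothesis enclosed_inner : forall u p q,
  path (adj G) u p -> path (adj G) u q -> last u p = last u q ->
  forall f, enclosed (eids u p ++ eids u q) f -> inner f.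

Lemma adj_net u v : adj G u v -> net_edge u v.
Proof. by move=> /asboolP/G_net. Qed.

Lemma path_adj_net u p : path (adj G) u p -> path net_edge u p.
Proof. exact/sub_path/adj_net. Qed.

Lemma adj_sym u v : adj G u v -> adj G v u.
Proof. by move=> /asboolP uv; exact/asboolP/edge_sym. Qed.

Lemma face_boundary_path f u p : inner f ->
  path net_edge u p -> all (borders f) (eids u p) -> path (adj G) u p.
Proof.
move=> If; elim: p u => //= v p IH u /andP[uv /IH {}IH] /andP[bf /IH ->].
rewrite andbT; have [b [uE vE]] := eid_ofK uv.
by apply/asboolP; rewrite {1}uE {2}vE; exact: inner_edge bf.
Qed.

Definition zone_size (l : line) (r : int) (n : nat) : nat :=
  \sum_(k < n) (if (face_at l (r + k%:Z)).1 then 1 else 3).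

(** A line crossed beside a face of the strip meets [l] in that face. By [lines_cross_once] it meets
    [l] in no other face, so steps around different faces cross different lines. *)
Lemma zone_up l r n b :
  (forall s, r <= s < r + n%:Z -> inner (face_at l s)) ->
  exists B, [/\ path (adj G) (ends (l, r) b) B,
    last (ends (l, r) b) B = ends (l, r + n%:Z) b, size B = zone_size l r n,
    uniq (l :: map fst (eids (ends (l, r) b) B)) &
    forall m, m \in map fst (eids (ends (l, r) b) B) ->
      exists2 s, r <= s < r + n%:Z & on_line (face_at l s) m].
Proof.
elim: n => [|n IH] inn.
  by exists [::]; rewrite /zone_size big_ord0 addr0.
have [s sn|B [pB lB sB uB onB]] := IH; first by apply: inn; lia.
have In : inner (face_at l (r + n%:Z)) by apply: inn; lia.
have nS : r + n.+1%:Z = r + n%:Z + 1 by lia.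
exists (B ++ up l (r + n%:Z) b); rewrite cat_path pB lB last_cat lB up_last nS.
rewrite size_cat sB up_size /zone_size big_ord_recr /= eids_cat lB map_cat.
have upL m : m \in map fst (eids (ends (l, r + n%:Z) b) (up l (r + n%:Z) b)) ->
    on_line (face_at l (r + n%:Z)) m.
  by move=> /mapP[e /(allP (up_borders l (r + n%:Z) b)) /borders_on_line + ->].
have /= := up_kinds l (r + n%:Z) b => /andP[lk uk].
have lup : l \notin map fst (eids (ends (l, r + n%:Z) b) (up l (r + n%:Z) b)).
  apply: contra lk => /mapP[e eup lE]; apply/mapP; exists e => //.
  by rewrite lE.
split=> //.
- exact: face_boundary_path In (up_path _ _ _) (up_borders _ _ _).
- move: uB; rewrite /= mem_cat negb_or lup => /andP[-> uB] /=.
  rewrite cat_uniq uB /=; apply/andP; split=> //; last first.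
    by apply: (@map_uniq _ _ fst); rewrite -map_comp.
  apply/hasPn => m mup; apply/negP => /onB[s sn ons].
  have lm : l != m by apply/eqP => lm; move: lup; rewrite {1}lm mup.
  have := lines_cross_once lm (face_at_on_line l s) ons (face_at_on_line _ _) (upL _ mup).
  by move=> /face_at_inj; lia.
- move=> m; rewrite mem_cat => /orP[/onB[s sn ons]|/upL on].
    by exists s => //; lia.
  by exists (r + n%:Z) => //; lia.
Qed.

(** The face at [t] lies between the edges at [t] and [t + 1], hence the half-open range. *)
Definition linked (l : line) (r s : int) : Prop :=
  forall t, Num.min r s <= t < Num.max r s -> inner (face_at l t).

Lemma zone l r s : linked l r s -> exists n, forall b, exists B,
  [/\ path (adj G) (ends (l, r) b) B, last (ends (l, r) b) B = ends (l, s) b,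
      size B = n & uniq (l :: map fst (eids (ends (l, r) b) B))].
Proof.
move=> lk; have [rs|sr] := leP r s.
  exists (zone_size l r `|s - r|) => b.
  have [t ht|B [pB lB sB uB _]] := @zone_up l r `|s - r| b; first by apply: lk; lia.
  by exists B; split=> //; rewrite lB; congr (ends (_, _)); lia.
exists (zone_size l s `|r - s|) => b.
have [t ht|B [pB lB sB uB _]] := @zone_up l s `|r - s| b; first by apply: lk; lia.
have rE : s + `|r - s|%N = r by lia.
have [q [pq lq eq]] := 
  rev_path_labels (lab := eid_of) (fun _ _ h => eid_ofC (adj_net h)) pB.
move: pq lq eq; rewrite lB rE => pq lq eq; exists q; split=> //.
  rewrite -sB -(size_pairmap eid_of (ends (l, r) b)) -/(labels _ _ _) eq.
  by rewrite size_rev size_pairmap.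
rewrite /eids -/(labels eid_of _ _) eq map_rev.
by move: uB; rewrite /= mem_rev rev_uniq.
Qed.

(** The class is stored as its set of positions, so that edges are equivalent when their labels are
    equal. *)
Definition edge_class (e : eid) : line * set int := (e.1, [set s | linked e.1 e.2 s]).

Lemma linked_refl l r : linked l r r.
Proof. by move=> t; lia. Qed.

Lemma edge_class_linked l r e :
  edge_class (l, r) = edge_class e -> e.1 = l /\ linked l r e.2.
Proof.
case=> -> /(congr1 (fun A : set int => A e.2)) /= lk; split=> //.
by rewrite lk; exact: linked_refl.
Qed.

(** Diagonal lines have two positions per column, hence the factor 2. *)
Lemma face_at_in l r : face_in N (face_at l r) -> `|r| <= `|N| * 2 + 2.
Proof.
case: l => [[[] []] k]; have [i [t ->]] := zigP r; rewrite /face_in /= ?zigE;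
  by case: t => /=; lia.
Qed.

(** The nearest faces on the line that are not inner; they exist because inner faces lie in a box.
    The edge at [r] lies between the faces at [r - 1] and [r], so [hi] may equal [r] and [lo] may
    not. *)
Lemma class_bounds l (r : int) : exists lo hi, [/\ lo < r <= hi, ~ inner (face_at l lo),
  ~ inner (face_at l hi) & forall t, lo < t < hi -> inner (face_at l t)].
Proof.
have far s : `|N| * 2 + 2 < `|s| -> ~ inner (face_at l s).
  by move=> sN /inner_in /face_at_in; lia.
have exhi : exists n : nat, `[< ~ inner (face_at l (r + n%:Z)) >].
  by exists (`|N| * 2 + 3 + `|r|)%N; apply/asboolP/far; lia.
have exlo : exists n : nat, `[< ~ inner (face_at l (r - 1 - n%:Z)) >].
  by exists (`|N| * 2 + 3 + `|r|)%N; apply/asboolP/far; lia.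
have [n /asboolP nhi hi_min] := ex_minnP exhi.
have [m /asboolP mlo lo_min] := ex_minnP exlo.
exists (r - 1 - m%:Z), (r + n%:Z); split=> //; first by lia.
move=> t tmn; apply: contrapT => nt; have [tr|tr] := leP r t.
  have := hi_min `|t - r|%N; rewrite (_ : r + _ = t); last by lia.
  by move=> /(_ (asboolT nt)); lia.
have := lo_min (absz (r - 1 - t)%R); rewrite (_ : r - 1 - _ = t); last by lia.
by move=> /(_ (asboolT nt)); lia.
Qed.

Lemma edge_class_interval l r lo hi : lo < r <= hi ->
  ~ inner (face_at l lo) -> ~ inner (face_at l hi) ->
  (forall t, lo < t < hi -> inner (face_at l t)) ->
  edge_class (l, r) = (l, [set s | lo < s <= hi]).
Proof.
move=> rlh nlo nhi inn; congr pair; apply/seteqP; split=> s /=.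
  move=> lk; apply: contrapT => ns.
  have [slo|los] := leP s lo; first by apply: nlo; apply: lk; lia.
  by apply: nhi; apply: lk; lia.
by move=> slh t ht; apply: inn; lia.
Qed.

(** A telescoping sum of [enclosed_boundary]. *)
Lemma interval_parity W l lo (n : nat) : balanced W ->
  par (fun e => (e.1 == l) && (lo < e.2 <= lo + n%:Z)) W =
  enclosed W (face_at l lo) (+) enclosed W (face_at l (lo + n%:Z)).
Proof.
move=> bal; elim: n => [|n IH].
  rewrite addr0 addbb /par (@eq_count _ _ pred0) ?count_pred0 // => e /=.
  by apply/negP; lia.
have -> : par (fun e => (e.1 == l) && (lo < e.2 <= lo + n.+1%:Z)) W =
    par (fun e => (e.1 == l) && (lo < e.2 <= lo + n%:Z)) W (+)
    par (pred1 (l, lo + n.+1%:Z)) W.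
  rewrite par_xor /par; congr odd; apply: eq_count => -[m s] /=.
  by rewrite xpair_eqE; case: (m == l) => //=; lia.
rewrite IH -enclosed_boundary // (_ : lo + n.+1%:Z - 1 = lo + n%:Z); last by lia.
by rewrite addbA -[X in X (+) _]addbA addbb addbF.
Qed.

(** A class fills the positions between two faces that are not inner, hence not enclosed, so both
    terms of [interval_parity] vanish. *)
Lemma class_parity W k : balanced W -> (forall f, enclosed W f -> inner f) ->
  par (fun e => edge_class e == k) W = false.
Proof.
move=> bal encI; apply/negP => pk; have [[l r] _ /eqP kE] := par_mem pk.
have [lo [hi [rlh nlo nhi inn]]] := class_bounds l r.
suff : par (fun e => edge_class e == k) W = false by rewrite pk.
have hiE : lo + `|hi - lo|%N%:Z = hi by lia.
have -> : par (fun e => edge_class e == k) W =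
    par (fun e => (e.1 == l) && (lo < e.2 <= lo + `|hi - lo|%N%:Z)) W.
  congr odd; apply: eq_count => -[m s] /=; rewrite hiE -kE; apply/eqP/andP => /=.
    rewrite (@edge_class_interval l r lo hi) // => -[-> /(congr1 (fun A : set int => A s))].
    by move=> /= sE; split=> //; rewrite -sE; exact: linked_refl.
  by case=> /eqP -> slh; rewrite !(@edge_class_interval l _ lo hi).
rewrite interval_parity // hiE.
have nE s : ~ inner (face_at l s) -> enclosed W (face_at l s) = false.
  by move=> ns; apply/negP => /encI.
by rewrite !nE.
Qed.

Definition class_label (u v : node) : line * set int := edge_class (eid_of u v).

Lemma class_labelE u p : labels class_label u p = map edge_class (eids u p).
Proof. by elim: p u => //= v p IH u; rewrite /labels /= -/(labels _ _ _) IH. Qed.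

Lemma class_label_parity : parity_invariant G class_label.
Proof.
move=> u p q _ pp pq lpq k; rewrite !class_labelE !count_map.
have bal := balanced_paths (path_adj_net pp) (path_adj_net pq) lpq.
have := class_parity k bal (enclosed_inner pp pq lpq).
by rewrite /par count_cat oddD; case: (odd _); case: (odd _).
Qed.

Lemma class_label_detours : detours_shorten G class_label.
Proof.
move=> u v p w; rewrite /= rcons_path => /and3P[uv pp qw] labE nin.
have [b [uE vE]] := eid_ofK (adj_net uv).
have [c [xE wE]] := eid_ofK (adj_net qw).
move: labE nin uE vE xE wE; rewrite /class_label.
case: (eid_of u v) => l r; case: (eid_of (last v p) w) => l' r' labE nin uE vE xE wE.
have [/= ll' lk] := edge_class_linked labE; rewrite {l'}ll' in labE xE wE.
have [n zn] := zone lk.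
(* [B] follows the strip on the side of [v]. *)
have [B [pB lB sB uB]] := zn (~~ b); rewrite -vE in pB lB uB.
have Gv : vert G v by case: (adj_vert uv).
have kB : edge_class (l, r) \notin labels class_label v B.
  rewrite class_labelE; apply/mapP => -[e eB eE]; have [le _] := edge_class_linked eE.
  by move: uB => /= /andP[/negP + _]; apply; rewrite -le; exact: map_f.
(* The second crossing must return to the side of [u]. Otherwise [B] continued through the last edge
   backwards has the ends of [p], yet it crosses the class once and [p] does not cross it. *)
have cb : c = ~~ b.
  have [//|cb] := eqVneq c (~~ b); exfalso.
  have {}cb : c = b by move: cb; case: (c); case: (b).
  have pBw : path (adj G) v (rcons B (last v p)).
    by rewrite rcons_path pB lB xE cb adj_sym // -cb -xE -wE.
  have := class_label_parity Gv pp pBw _ (edge_class (l, r)).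
  rewrite last_rcons -cats1 labels_cat count_cat /= lB xE cb => /(_ erefl).
  rewrite (count_memPn nin) (count_memPn kB) /class_label.
  by have := ends_sym (l, r') (~~ b); rewrite negbK => ->; rewrite labE eqxx.
have uL : uniq (labels class_label v B).
  rewrite class_labelE; move: uB => /= /andP[_ uB].
  by apply: (@map_uniq _ _ fst); rewrite -map_comp.
(* The labels of [B] are distinct, and by parity each of them occurs in [p]. *)
rewrite cb -lB in xE; have szB : (size B <= size p)%N.
  rewrite -(size_pairmap class_label v B) -(size_pairmap class_label v p).
  apply: uniq_leq_size => [|k kB'].
    exact: uL.
  have := class_label_parity Gv pB pp (esym xE) k.
  rewrite (count_uniq_mem _ uL) -/(labels _ _ _) kB' /=; rewrite -has_pred1 has_count.
  by case: count.
(* The opposite side of the strip, as long as [B], replaces [p] and saves both crossings. *)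
have [B' [pB' lB' sB' _]] := zn b; rewrite -uE in pB' lB'.
exists B'; split=> //; first by rewrite lB' wE cb negbK.
by rewrite sB' -sB ltnS leqW.
Qed.

Hypothesis vert_in : forall u, vert G u -> node_in N u.

Lemma inner_faces_partial_cube (v0 : node) : vert G v0 ->
  (forall u v, vert G u -> vert G v -> exists p, path (adj G) u p /\ last u p = v) ->
  partial_cube G.
Proof.
move=> Gv0 conn; have [s sP] := node_in_finite N.
apply: (@partial_cube_criterion _ _ G class_label v0
  (undup [seq class_label u v | u <- s, v <- s])) => //.
- exact: undup_uniq.
- move=> u v /adj_vert[Gu Gv]; rewrite mem_undup.
  by apply: allpairs_f; apply/sP/vert_in.
- exact: class_label_parity.
- exact: class_label_detours.
Qed.

End InnerFaces.

(** * Faces and edges as convex subsets of the plane *)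

Section Geometry.
Variable R : realType.
Implicit Types (q : R * R) (e : eid) (f g : face).

(** Neighbouring squares, of half-diagonal 1, are disjoint; the comparisons of coordinates below
    rest on this inequality. *)
Lemma period_gt2 : 2 < period R.
Proof. by rewrite /period ltrDl sqrtr_gt0. Qed.

Definition grid (i : int) : R := period R * i%:~R.

Lemma gridD i j : grid (i + j) = grid i + grid j.
Proof. by rewrite /grid rmorphD mulrDr. Qed.

Lemma grid1 : grid 1 = period R.
Proof. by rewrite /grid mulr1. Qed.

Lemma grid_le i j : i <= j -> grid i <= grid j.
Proof.
by move=> ij; rewrite ler_wpM2l ?ler_int //; have := period_gt2; lra.
Qed.

Lemma grid_lt i j : i < j -> grid i + period R <= grid j.
Proof. by move=> ij; rewrite -grid1 -gridD grid_le; lia. Qed.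

Lemma grid_ltS i j : grid i < grid j + period R -> i <= j.
Proof. by move=> ij; rewrite leNgt; apply/negP => /grid_lt; lra. Qed.

(** Turns estimates on real coordinates into equality of indices. *)
Lemma grid_eq i j : grid i < grid j + period R -> grid j < grid i + period R -> i = j.
Proof. by move=> /grid_ltS ij /grid_ltS ji; lia. Qed.

Lemma gridS i : grid (i + 1) = grid i + period R.
Proof. by rewrite gridD grid1. Qed.

(** A triple [(a, b, c)] stands for the inequality between a x + b y and c, strict for the open face
    and large for the closed one. *)
Definition halfplanes f : seq (R * R * R) :=
  let: (sq, (i, j)) := f in
  let x := grid i in let y := grid j in let P := period R in
  if sq then
    [:: (1, 1, x + y + 1); (1, -1, x - y + 1); (-1, 1, - x + y + 1);
        (-1, -1, - x - y + 1)]
  else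
    [:: (-1, 0, - x); (1, 0, x + P); (0, -1, - y); (0, 1, y + P);
        (-1, -1, - x - y - 1); (1, -1, x + P - y - 1); (-1, 1, - x + y + P - 1);
        (1, 1, x + y + 2 * P - 1)].

Definition eval (h : R * R * R) q : R := h.1.1 * q.1 + h.1.2 * q.2.

Definition closed_face f : set (R * R) :=
  [set q | all (fun h => eval h q <= h.2) (halfplanes f)].

Definition open_face f : set (R * R) :=
  [set q | all (fun h => eval h q < h.2) (halfplanes f)].

Definition centre f : R * R :=
  let: (sq, (i, j)) := f in
  if sq then (grid i, grid j) else (grid i + period R / 2, grid j + period R / 2).

Lemma centre_open f : open_face f (centre f).
Proof.
have := period_gt2; case: f => [[] [i j]] p2; rewrite /open_face /eval /=;
  by rewrite ?andbT; do ?[apply/andP; split]; lra.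
Qed.

Lemma open_face_star f q t : closed_face f q -> 0 <= t < 1 ->
  open_face f ((1 - t) *: centre f + t *: q).
Proof.
move=> /allP fq /andP[t0 t1]; apply/allP => h hf.
have := allP (centre_open f) h hf; have := fq h hf.
rewrite /eval /= /GRing.scale /=; case: h {hf} => [[a b] c] /=.
case: q {fq} => x y; case: (centre f) => x' y' /= h1 h2.
have -> : a * ((1 - t) * x' + t * x) + b * ((1 - t) * y' + t * y) =
  (1 - t) * (a * x' + b * y') + t * (a * x + b * y) by ring.
have -> : c = (1 - t) * c + t * c by ring.
by apply: ltr_leD; [rewrite ltr_pM2l ?subr_gt0|exact: ler_wpM2l].
Qed.

Lemma closed_face_closed f : closed (closed_face f).
Proof.
rewrite /closed_face; elim: (halfplanes f) => [|h hs IH] /=.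
  by rewrite (_ : mkset _ = setT); [exact: closedT|apply/seteqP; split].
rewrite (_ : mkset _ = [set q | eval h q <= h.2] `&`
    [set q | all (fun h => eval h q <= h.2) hs]).
  apply: closedI => //.
  apply: (@closed_comp _ _ (eval h) [set x | x <= h.2]); last exact: closed_le.
  move=> q _; apply: cvgD; apply: cvgM; try exact: cvg_cst; [exact: cvg_fst|exact: cvg_snd].
by apply/seteqP; split=> q /= => [/andP[]|[-> ->]].
Qed.

(** Linear conditions, suited to [lra], in place of the parametrised segment; [strict] removes the
    ends. *)
Definition on_edge (strict : bool) e q : Prop :=
  let: (d, o, k, r) := e in
  let le (x y : R) := if strict then x < y else x <= y in
  match d, o with
  | false, false => [/\ le (grid k + 1) q.1, le q.1 (grid k + period R - 1) & q.2 = grid r]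
  | false, true => [/\ le (grid k + 1) q.2, le q.2 (grid k + period R - 1) & q.1 = grid r]
  | true, false => let: (i, t) := zig r in let x := grid i in let y := grid (i - k) in
    if t then [/\ le x q.1, le y q.2 & q.1 + q.2 = x + y + 1]
    else [/\ le q.1 x, le q.2 y & q.1 + q.2 = x + y - 1]
  | true, true => let: (i, t) := zig r in let x := grid i in let y := grid (k - i) in
    if t then [/\ le x q.1, le q.2 y & q.1 - q.2 = x - y + 1]
    else [/\ le q.1 x, le y q.2 & q.1 - q.2 = x - y - 1]
  end.

Definition sign (b : bool) : R := if b then 1 else -1.

(* The side of the square (i, j) facing east if s, west if not, and north if t, *)
(* south if not.                                                                *)
Definition square_side (i j : int) (s t : bool) : eid :=
  (true, s (+) t, if s (+) t then i + j else i - j, i * 2 + s%:Z).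

(** Here a diagonal edge is better described by its square and quadrant than by its cut line. *)
Variant eid_spec : eid -> Prop :=
  | EidColumn i j : eid_spec (false, false, i, j)
  | EidRow i j : eid_spec (false, true, j, i)
  | EidSide i j s t : eid_spec (square_side i j s t).

Lemma eidP e : eid_spec e.
Proof.
case: e => [[[[] []] k] r]; have [i [s ->]] := zigP r.
- by have := EidSide i (k - i) s (~~ s); rewrite /square_side addbN addbb /= addrC subrK.
- by have := EidSide i (i - k) s s; rewrite /square_side addbb /= subKr.
- exact: EidRow.
- exact: EidColumn.
Qed.

Lemma on_square_side strict i j s t q :
  on_edge strict (square_side i j s t) q <->
  let le (x y : R) := if strict then x < y else x <= y in
  [/\ le 0 (sign s * (q.1 - grid i)), le 0 (sign t * (q.2 - grid j)) &
      sign s * (q.1 - grid i) + sign t * (q.2 - grid j) = 1].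
Proof.
rewrite /on_edge /square_side /sign; case: q => x y.
by case: s; case: t; rewrite /= zig_simp /= ?subKr ?[i + j]addrC ?addrK;
  case: strict => /=; split=> -[h1 h2 h3]; split; lra.
Qed.

Lemma on_square_side_near i j s t q : on_edge false (square_side i j s t) q ->
  (-1 <= q.1 - grid i <= 1) /\ (-1 <= q.2 - grid j <= 1).
Proof.
by move=> /on_square_side /=; rewrite /sign; case: s; case: t => -[h1 h2 h3]; lra.
Qed.

Lemma on_edgeW e q : on_edge true e q -> on_edge false e q.
Proof.
case: e => [[[[] []] k] r] /=; last 2 first.
- by case=> /ltW ? /ltW ? ?.
- by case=> /ltW ? /ltW ? ?.
- by case: (zig r) => i [] [/ltW ? /ltW ? ?].
- by case: (zig r) => i [] [/ltW ? /ltW ? ?].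
Qed.

Lemma grid_gap i j (x : R) : grid i + 1 < x < grid i + period R - 1 ->
  -1 <= x - grid j <= 1 -> False.
Proof.
have := period_gt2 => p2 hi hj.
have ij : i <= j by apply: grid_ltS; lra.
have ji : j <= i by apply: grid_ltS; lra.
by have ijE : i = j by [lia]; subst j; lra.
Qed.

(** Planarity of the drawing: a point inside an edge lies on the curve only if that very edge is on
    the cycle. *)
Lemma on_edge_inj e e' q : on_edge true e q -> on_edge false e' q -> e = e'.
Proof.
have := period_gt2; case: q => x y p2.
case: (eidP e) => [i j|i j|i j s t].
- case=> /= h1 h2 ->; case: (eidP e') => [i' j'|i' j'|i' j' s' t'].
  + case=> /= h1' h2' yE; have -> : i = i' by apply: grid_eq; lra.
    by have -> : j = j' by apply: grid_eq; lra.
  + by case=> /= _ _ xE; exfalso; apply: (@grid_gap i i' x); lra.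
  + by case/on_square_side_near => /= h _; exfalso; apply: (@grid_gap i i' x); lra.
- case=> /= h1 h2 ->; case: (eidP e') => [i' j'|i' j'|i' j' s' t'].
  + by case=> /= _ _ yE; exfalso; apply: (@grid_gap j j' y); lra.
  + case=> /= h1' h2' xE; have -> : j = j' by apply: grid_eq; lra.
    by have -> : i = i' by apply: grid_eq; lra.
  + by case/on_square_side_near => /= _ h; exfalso; apply: (@grid_gap j j' y); lra.
- move=> eq; have [/= nx ny] := on_square_side_near (on_edgeW eq).
  move: eq => /on_square_side /= eq.
  case: (eidP e') => [i' j'|i' j'|i' j' s' t'].
  + case=> /= _ _ yE; have jE : j = j' by apply: grid_eq; lra.
    by subst j'; move: eq; rewrite yE subrr mulr0 => -[_]; rewrite ltxx.
  + case=> /= _ _ xE; have iE : i = i' by apply: grid_eq; lra.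
    by subst i'; move: eq; rewrite xE subrr mulr0 => -[]; rewrite ltxx.
  + move=> eq'; have [/= nx' ny'] := on_square_side_near eq'.
    move: eq' => /on_square_side /= eq'.
    have iE : i = i' by apply: grid_eq; lra.
    have jE : j = j' by apply: grid_eq; lra.
    subst i' j'; move: eq eq'; rewrite /sign => -[h1 h2 h3] [h1' h2' h3'].
    have -> : s = s' by case: (s) (s') h1 h1' {h2 h2' h3 h3'}
      => [] [] // ? ?; exfalso; lra.
    by have -> : t = t' by case: (t) (t') h2 h2' {h1 h1' h3 h3'}
      => [] [] // ? ?; exfalso; lra.
Qed.

Lemma on_edge_pos e u : on_edge false e (pos R u) -> exists b, u = ends e b.
Proof.
have := period_gt2 => p2; case: u => [[i' j'] [a s']] /=.
rewrite -/(grid i') -/(grid j').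
set x := grid i' + _; set y := grid j' + _.
have nx : -1 <= x - grid i' <= 1 by rewrite /x; case: (a); case: (s'); lra.
have ny : -1 <= y - grid j' <= 1 by rewrite /y; case: (a); case: (s'); lra.
case: (eidP e) => [i j|i j|i j s t].
- case=> /= h1 h2 yE; have jE : j = j' by apply: grid_eq; lra.
  subst j'; have aE : a = false.
    by apply/negP => aT; move: yE; rewrite /y aT; case: (s'); lra.
  subst a; move: h1 h2; rewrite /x; case: (s') => /= h1 h2.
    by exists false; have -> : i = i' by apply: grid_eq; lra.
  by exists true; have -> : i' = i + 1 by apply: grid_eq; rewrite gridS; lra.
- case=> /= h1 h2 xE; have iE : i = i' by apply: grid_eq; lra.
  subst i'; have aE : a = true.
    by apply/negPn/negP => /negbTE aF; move: xE; rewrite /x aF; case: (s'); lra.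
  subst a; move: h1 h2; rewrite /y; case: (s') => /= h1 h2.
    by exists false; have -> : j = j' by apply: grid_eq; lra.
  by exists true; have -> : j' = j + 1 by apply: grid_eq; rewrite gridS; lra.
- move=> eq; have [/= nx' ny'] := on_square_side_near eq.
  have iE : i = i' by apply: grid_eq; lra.
  have jE : j = j' by apply: grid_eq; lra.
  subst i' j'.
  have endE b : ends (square_side i j s t) b =
      ((i, j), (if s == t then ~~ (b (+) s) else b (+) s, if s == t then s else b)).
    by rewrite /square_side /ends; case: (s); case: (t);
      rewrite /= zig_simp ?subKr ?[i + j]addrC ?addrK.
  suff : exists b, (a, s') =
      (if s == t then ~~ (b (+) s) else b (+) s, if s == t then s else b).
    by case=> b bE; exists b; apply: etrans (esym (endE b)); rewrite bE.
  move: eq => /on_square_side /=; rewrite /x /y /sign.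
  case: (a) => h; [exists (if s == t then s else t)|exists (if s == t then ~~ s else s)].
    have -> : s' = t by case: (s) (t) (s') h => [] [] [] [? ? ?] //; exfalso; lra.
    by case: (s); case: (t).
  have -> : s' = s by case: (s) (t) (s') h => [] [] [] [? ? ?] //; exfalso; lra.
  by case: (s); case: (t).
Qed.


Lemma closed_square i j q : closed_face (true, (i, j)) q <->
  [/\ q.1 + q.2 <= grid i + grid j + 1, q.1 - q.2 <= grid i - grid j + 1,
      - q.1 + q.2 <= - grid i + grid j + 1 & - q.1 - q.2 <= - grid i - grid j + 1].
Proof.
rewrite /closed_face /eval /= andbT; split=> [/and4P[? ? ? ?]|[? ? ? ?]].
  by split; lra.
by apply/and4P; split; lra.
Qed.

Lemma closed_octagon i j q : closed_face (false, (i, j)) q <->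
  [/\ grid i <= q.1 <= grid i + period R, grid j <= q.2 <= grid j + period R,
     grid i + grid j + 1 <= q.1 + q.2 <= grid i + grid j + 2 * period R - 1 &
     grid i - grid j - period R + 1 <= q.1 - q.2 <= grid i - grid j + period R - 1].
Proof.
rewrite /closed_face /eval /= andbT; split.
  by move=> /and4P[? ? ? /and5P[? ? ? ? ?]]; split; lra.
move=> [/andP[? ?] /andP[? ?] /andP[? ?] /andP[? ?]].
by apply/and4P; split; [lra..|]; apply/and5P; split; lra.
Qed.

Lemma open_square i j q : open_face (true, (i, j)) q ->
  [/\ q.1 + q.2 < grid i + grid j + 1, q.1 - q.2 < grid i - grid j + 1,
      - q.1 + q.2 < - grid i + grid j + 1 & - q.1 - q.2 < - grid i - grid j + 1].
Proof. by rewrite /open_face /eval /= andbT => /and4P[? ? ? ?]; split; lra. Qed.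

Lemma open_octagon i j q : open_face (false, (i, j)) q ->
  [/\ grid i < q.1 < grid i + period R, grid j < q.2 < grid j + period R,
     grid i + grid j + 1 < q.1 + q.2 < grid i + grid j + 2 * period R - 1 &
     grid i - grid j - period R + 1 < q.1 - q.2 < grid i - grid j + period R - 1].
Proof.
by rewrite /open_face /eval /= andbT => /and4P[? ? ? /and5P[? ? ? ? ?]]; split; lra.
Qed.

Lemma grid_eq2 i i' : grid i < grid i' + period R ->
  grid i' < grid i + 2 * period R -> i' = i \/ i' = i + 1.
Proof.
move=> /grid_ltS h1 h2; have : i' <= i + 1 by apply: grid_ltS; rewrite gridS; lra.
by have [->|] := eqVneq i' i; [left|right; lia].
Qed.

Lemma open_face_edge f e q : open_face f q -> on_edge false e q -> False.
Proof.
have := period_gt2; case: q => x y p2; case: f => [[] [i j]].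
  move=> /open_square /= [h1 h2 h3 h4].
  case: (eidP e) => [i' j'|i' j'|i' j' s t].
  - case=> /= g1 g2 g3; have jE : j = j' by apply: grid_eq; lra.
    subst j'; have : i <= i' by apply: grid_ltS; lra.
    rewrite le_eqVlt => /predU1P[iE|/grid_lt]; last by lra.
    by subst i'; lra.
  - case=> /= g1 g2 g3; have iE : i = i' by apply: grid_eq; lra.
    subst i'; have : j <= j' by apply: grid_ltS; lra.
    rewrite le_eqVlt => /predU1P[jE|/grid_lt]; last by lra.
    by subst j'; lra.
  - move=> eq; have [/= nx ny] := on_square_side_near eq.
    have iE : i = i' by apply: grid_eq; lra.
    have jE : j = j' by apply: grid_eq; lra.
    subst i' j'; move: eq => /on_square_side /= [_ _].
    by rewrite /sign; case: (s); case: (t); lra.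
move=> /open_octagon /= [h1 h2 h3 h4].
case: (eidP e) => [i' j'|i' j'|i' j' s t].
- case=> /= _ _ g3; have jE : j = j' by apply: grid_eq; lra.
  by subst j'; lra.
- case=> /= _ _ g3; have iE : i = i' by apply: grid_eq; lra.
  by subst i'; lra.
- move=> eq; have [/= nx ny] := on_square_side_near eq.
  have iE : i' = i \/ i' = i + 1 by apply: grid_eq2; lra.
  have jE : j' = j \/ j' = j + 1 by apply: grid_eq2; lra.
  move: eq => /on_square_side /=; rewrite /sign; move=> [g1 g2 g3].
  case: iE g1 g2 g3 {nx ny} => ->; case: jE => ->; rewrite ?gridS;
    by case: (s); case: (t) => g1 g2 g3; lra.
Qed.

Lemma on_edge_closed_face f e q : borders f e -> on_edge false e q -> closed_face f q.
Proof.
have := period_gt2; case: q => x y p2.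
have BE i : grid (i - 1) = grid i - period R.
  by apply/eqP; rewrite eq_sym subr_eq -gridS subrK.
case: (eidP e) => [i j|i j|i j s t].
- move=> + [/= h1 h2 h3]; case/orP => /eqP <- /=; apply/closed_octagon => /=;
    by rewrite ?BE; split; lra.
- move=> + [/= h1 h2 h3]; case/orP => /eqP <- /=; apply/closed_octagon => /=;
    by rewrite ?BE; split; lra.
- move=> bf /on_square_side /= eq; suff : f = (true, (i, j)) \/
      f = (false, (if s then i else i - 1, if t then j else j - 1)).
    move: eq; rewrite /sign => -[h1 h2 h3] [] ->.
      apply/closed_square => /=.
      by case: (s) (t) h1 h2 h3 => [] [] h1 h2 h3; split; lra.
    apply/closed_octagon => /=.
    by case: (s) (t) h1 h2 h3 => [] [] h1 h2 h3; rewrite ?BE; split; lra.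
  move: bf; rewrite /borders /square_side /face_at.
  by case: (s); case: (t); rewrite /= !zig_simp /= => /orP[] /eqP <-;
    ((by left; congr (_, (_, _)); lia) || (by right; congr (_, (_, _)); lia)).
Qed.

Definition separated_by e f g :=
  (face_at e.1 e.2 = f /\ face_at e.1 (e.2 - 1) = g) \/
  (face_at e.1 e.2 = g /\ face_at e.1 (e.2 - 1) = f).

Lemma square_side_separates i j s t : separated_by (square_side i j s t)
  (true, (i, j)) (false, (if s then i else i - 1, if t then j else j - 1)).
Proof.
rewrite /separated_by /square_side /face_at.
case: s; case: t; rewrite /= !zig_simp /=; [right|right|left|left];
  by split; congr (_, (_, _)); lia.
Qed.

Lemma square_octagon_edge i j i' j' q :
  closed_face (true, (i, j)) q -> closed_face (false, (i', j')) q ->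
  exists2 e, separated_by e (true, (i, j)) (false, (i', j')) & on_edge false e q.
Proof.
have := period_gt2; case: q => x y p2 /closed_square /= [h1 h2 h3 h4].
move=> /closed_octagon /= [g1 g2 g3 g4].
have iE : i = i' \/ i = i' + 1 by apply: grid_eq2; lra.
have jE : j = j' \/ j = j' + 1 by apply: grid_eq2; lra.
case: iE => iE; case: jE => jE; subst; rewrite ?gridS in h1 h2 h3 h4.
- exists (square_side i' j' true true).
    exact: (square_side_separates _ _ true true).
  by apply/on_square_side; rewrite /sign /=; split; lra.
- exists (square_side i' (j' + 1) true false).
    by have := square_side_separates i' (j' + 1) true false; rewrite addrK.
  by apply/on_square_side; rewrite /sign /= gridS; split; lra.
- exists (square_side (i' + 1) j' false true).
    by have := square_side_separates (i' + 1) j' false true; rewrite addrK.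
  by apply/on_square_side; rewrite /sign /= gridS; split; lra.
- exists (square_side (i' + 1) (j' + 1) false false).
    by have := square_side_separates (i' + 1) (j' + 1) false false; rewrite !addrK.
  by apply/on_square_side; rewrite /sign /= !gridS; split; lra.
Qed.

End Geometry.

(** * Contacts between faces, covering by faces, and edges as segments *)

Section Geometry2.
Variable R : realType.
Implicit Types (q : R * R) (e : eid) (f g : face).

Lemma octagon_octagon_edge i j i' j' q : (i, j) != (i', j') ->
  closed_face (false, (i, j)) q -> closed_face (false, (i', j')) q ->
  exists2 e, separated_by e (false, (i, j)) (false, (i', j')) & on_edge false e q.
Proof.
have := period_gt2 R; case: q => x y p2 ij.
move=> /closed_octagon /= [h1 h2 h3 h4] /closed_octagon /= [g1 g2 g3 g4].
have cmp k l : grid R k <= grid R l + period R -> grid R l <= grid R k + period R ->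
    [\/ l = k, l = k + 1 | k = l + 1].
  move=> kl lk; have h : k <= l + 1 by apply: (@grid_ltS R); rewrite gridS; lra.
  have h' : l <= k + 1 by apply: (@grid_ltS R); rewrite gridS; lra.
  have [->|lk0] := eqVneq l k; first exact: Or31.
  have [->|lk1] := eqVneq l (k + 1); first exact: Or32.
  by apply: Or33; clear -h h' lk0 lk1; lia.
have iE : [\/ i' = i, i' = i + 1 | i = i' + 1] by apply: cmp; lra.
have jE : [\/ j' = j, j' = j + 1 | j = j' + 1] by apply: cmp; lra.
case: iE => iE; case: jE => jE; subst.
- by rewrite eqxx in ij.
- exists (false, false, i, j + 1); first by right; rewrite /= addrK.
  by move: g1 g2 g3 g4; rewrite gridS /= => g1 g2 g3 g4; split; rewrite ?gridS; lra.
- exists (false, false, i, j' + 1); first by left; rewrite /= addrK.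
  by move: h1 h2 h3 h4; rewrite gridS /= => h1 h2 h3 h4; split; rewrite ?gridS; lra.
- exists (false, true, j, i + 1); first by right; rewrite /= addrK.
  by move: g1 g2 g3 g4; rewrite gridS /= => g1 g2 g3 g4; split; rewrite ?gridS; lra.
- by exfalso; move: g1 g2 g3 g4; rewrite !gridS => *; lra.
- by exfalso; move: g1 g2 g3 g4 h1 h2 h3 h4; rewrite !gridS => *; lra.
- exists (false, true, j, i' + 1); first by left; rewrite /= addrK.
  by move: h1 h2 h3 h4; rewrite gridS /= => h1 h2 h3 h4; split; rewrite ?gridS; lra.
- by exfalso; move: g1 g2 g3 g4 h1 h2 h3 h4; rewrite !gridS => *; lra.
- by exfalso; move: g1 g2 g3 g4 h1 h2 h3 h4; rewrite !gridS => *; lra.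
Qed.

(** Vertices have degree 3, so even at a vertex any two of the faces share an edge: faces never
    touch at a mere corner. *)
Lemma closed_faces_meet f g q : f != g -> closed_face f q -> closed_face g q ->
  exists2 e, separated_by e f g & on_edge false e q.
Proof.
case: f g => [[] [i j]] [[] [i' j']] fg fq gq.
- exfalso; have := period_gt2 R; move: fq gq => /closed_square[h1 h2 h3 h4].
  move=> /closed_square[g1 g2 g3 g4] p2; move: fg.
  have -> : i = i' by apply: (@grid_eq R); lra.
  by have -> : j = j' by [apply: (@grid_eq R); lra]; rewrite eqxx.
- exact: square_octagon_edge.
- have [e sep eq] := square_octagon_edge gq fq; exists e => //.
  by case: sep => sep; [right|left].
- exact: octagon_octagon_edge.
Qed.

Lemma gridN i : grid R (- i) = - grid R i.
Proof. by rewrite /grid rmorphN mulrN. Qed.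

Lemma grid_floor (x : R) : exists i : int, grid R i <= x < grid R i + period R.
Proof.
have p0 : 0 < period R by have := period_gt2 R; lra.
exists (Num.floor (x / period R)); rewrite -gridS /grid.
rewrite ![period R * _]mulrC -ler_pdivlMr // -ltr_pdivrMr //.
by rewrite floor_le_tmp floorD1_gt.
Qed.

(** The cell spanned by four neighbouring square centres is one octagon and four triangles, each
    part of the square at its corner. *)
Lemma closed_faces_cover (N : int) q :
  - grid R N < q.1 < grid R N -> - grid R N < q.2 < grid R N ->
  exists2 f, face_in N f & closed_face f q.
Proof.
have p2 := period_gt2 R; case: q => x y /= xN yN.
have [i xi] := grid_floor x; have [j yj] := grid_floor y.
have bnd k (u : R) : - grid R N < u < grid R N -> grid R k <= u < grid R k + period R ->
    (- N <= k) && (k + 1 <= N).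
  move=> uN uk; apply/andP; split; first by apply: (@grid_ltS R); rewrite gridN; lra.
  rewrite lezD1 ltNge; apply/negP => /(grid_le R); lra.
have := bnd _ _ xN xi; have := bnd _ _ yN yj => jN iN.
have [h1|h1] := leP (x + y) (grid R i + grid R j + 1).
  exists (true, (i, j)); first by clear -iN jN; rewrite /face_in /=; lia.
  by apply/closed_square => /=; split; lra.
have [h2|h2] := leP (grid R i + grid R j + 2 * period R - 1) (x + y).
  exists (true, (i + 1, j + 1)); first by clear -iN jN; rewrite /face_in /=; lia.
  by apply/closed_square; rewrite !gridS /=; split; lra.
have [h3|h3] := leP (x - y) (grid R i - grid R j - period R + 1).
  exists (true, (i, j + 1)); first by clear -iN jN; rewrite /face_in /=; lia.
  by apply/closed_square; rewrite !gridS /=; split; lra.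
have [h4|h4] := leP (grid R i - grid R j + period R - 1) (x - y).
  exists (true, (i + 1, j)); first by clear -iN jN; rewrite /face_in /=; lia.
  by apply/closed_square; rewrite !gridS /=; split; lra.
exists (false, (i, j)); first by clear -iN jN; rewrite /face_in /=; lia.
by apply/closed_octagon => /=; split; lra.
Qed.

(** An octagon of index [N] extends to [grid R (N + 1)]; one more period makes the bound strict. *)
Lemma closed_face_bound N f q : face_in N f -> closed_face f q ->
  (- grid R (N + 2) < q.1 < grid R (N + 2)) /\ (- grid R (N + 2) < q.2 < grid R (N + 2)).
Proof.
have p2 := period_gt2 R; case: q f => x y [sq [i j]].
move=> /and4P[/= /(grid_le R) + /(grid_le R) + /(grid_le R) + /(grid_le R)].
have -> : grid R (N + 2) = grid R N + 2 * period R.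
  by rewrite (_ : N + 2 = N + 1 + 1) ?gridS; [lra|clear; lia].
rewrite gridN => iN Ni jN Nj; case: sq.
  by move=> /closed_square /= [h1 h2 h3 h4]; split; lra.
by move=> /closed_octagon /= [h1 h2 h3 h4]; split; lra.
Qed.

Lemma pos_square_side i j s t : exists b,
  pos R (ends (square_side i j s t) b) = (grid R i + sign R s, grid R j) /\
  pos R (ends (square_side i j s t) (~~ b)) = (grid R i, grid R j + sign R t).
Proof.
exists (if s == t then ~~ s else s); rewrite /square_side /ends.
by case: s; case: t; rewrite /= zig_simp /= ?subKr ?[i + j]addrC ?addrK
  /pos /sign /grid ?addr0.
Qed.

Definition lec (strict : bool) (x y : R) := if strict then x < y else x <= y.

Lemma convex_on_edge strict e b (t : R) : lec strict 0 t -> lec strict t 1 ->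
  on_edge strict e ((1 - t) *: pos R (ends e b) + t *: pos R (ends e (~~ b))).
Proof.
have p2 := period_gt2 R => t0 t1.
have tp0 : lec strict 0 (t * (period R - 2)).
  by move: t0; rewrite /lec; case: strict {t1} => t0;
    [apply: mulr_gt0|apply: mulr_ge0]; lra.
have tp1 : lec strict 0 ((1 - t) * (period R - 2)).
  by move: t1; rewrite /lec; case: strict {t0 tp0} => t0;
    [apply: mulr_gt0|apply: mulr_ge0]; lra.
case: (eidP e) => [i j|i j|i j s s'].
- move: tp0 tp1; rewrite /lec /on_edge /pos /=.
  by case: b; case: strict {t0 t1} => tp0 tp1;
    rewrite /= /GRing.scale /= -?/(grid R _) ?gridS; split; lra.
- move: tp0 tp1; rewrite /lec /on_edge /pos /=.
  by case: b; case: strict {t0 t1} => tp0 tp1;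
    rewrite /= /GRing.scale /= -?/(grid R _) ?gridS; split; lra.
- apply/on_square_side; have [c [cE nE]] := pos_square_side i j s s'.
  have [->|/eqP bc] := eqVneq b c.
    rewrite cE nE /= /GRing.scale /= /sign; move: t0 t1; rewrite /lec.
    by case: (s); case: (s'); case: strict {tp0 tp1} => t0 t1; split; lra.
  have -> : b = ~~ c by case: (b) (c) bc => [] [].
  rewrite negbK cE nE /= /GRing.scale /= /sign; move: t0 t1; rewrite /lec.
  by case: (s); case: (s'); case: strict {tp0 tp1} => t0 t1; split; lra.
Qed.

Lemma segment_on_edge e b q :
  segment (pos R (ends e b)) (pos R (ends e (~~ b))) q -> on_edge false e q.
Proof. by move=> [t /= /andP[t0 t1] <-]; exact: (@convex_on_edge false). Qed.

Lemma open_segment_on_edge e b q :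
  open_segment (pos R (ends e b)) (pos R (ends e (~~ b))) q -> on_edge true e q.
Proof. by move=> [t /= /andP[t0 t1] <-]; exact: (@convex_on_edge true). Qed.

Lemma segmentC (p q : R * R) : segment p q `<=` segment q p.
Proof.
move=> _ [t /andP[t0 t1] <-]; exists (1 - t) => /=; last by rewrite subKr addrC.
by apply/andP; split; lra.
Qed.

Lemma on_edge_segment e b q :
  on_edge false e q -> segment (pos R (ends e b)) (pos R (ends e (~~ b))) q.
Proof.
have p2 := period_gt2 R; have p20 : 0 < period R - 2 by lra.
suff [c] : exists c, on_edge false e q ->
    segment (pos R (ends e c)) (pos R (ends e (~~ c))) q.
  have [->//|/eqP bc] := eqVneq b c; move=> h /h /segmentC.
  by have -> : b = ~~ c by [case: (b) (c) bc => [] []]; rewrite negbK.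
case: q => x y; case: (eidP e) => [i j|i j|i j s s'].
- exists false => -[/= h1 h2 ->]; exists ((x - grid R i - 1) / (period R - 2)).
    by apply/andP; split; [rewrite ler_pdivlMr //|rewrite ler_pdivrMr //]; lra.
  by rewrite [LHS]surjective_pairing; congr pair;
    rewrite /= /GRing.scale /= -?/(grid R _) ?gridS; field; lra.
- exists false => -[/= h1 h2 ->]; exists ((y - grid R j - 1) / (period R - 2)).
    by apply/andP; split; [rewrite ler_pdivlMr //|rewrite ler_pdivrMr //]; lra.
  by rewrite [LHS]surjective_pairing; congr pair;
    rewrite /= /GRing.scale /= -?/(grid R _) ?gridS; field; lra.
- have [c [cE nE]] := pos_square_side i j s s'; exists c => /on_square_side /= [h1 h2 h3].
  rewrite cE nE; exists (sign R s' * (y - grid R j)); first by apply/andP; split; lra.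
  rewrite [LHS]surjective_pairing /= /GRing.scale /=; move: h1 h2 h3; rewrite /sign => h1 h2 h3.
  by case: (s) (s') h1 h2 h3 => [] [] h1 h2 h3; congr pair; lra.
Qed.

End Geometry2.

(** * Connected and bounded subsets of the plane *)

Section Plane.
Variable R : realType.
Implicit Types p q : R * R.

Lemma affine_connected p q (A : set R) : connected A ->
  connected [set (1 - t) *: p + t *: q | t in A].
Proof.
move=> Ac; apply: connected_continuous_connected => //.
apply: continuous_subspaceT => t.
apply: cvgD; apply: cvgZr_tmp; last exact: cvg_id.
by apply: cvgB; [exact: cvg_cst|exact: cvg_id].
Qed.

Lemma segment_connected_plane p q : connected (segment p q).
Proof.
apply: affine_connected; rewrite (_ : mkset _ = `[0, 1]%classic).
  exact: segment_connected.
by apply/seteqP; split=> t /=; rewrite in_itv.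
Qed.

Lemma ray_connected p q : connected [set p + t *: q | t in [set t : R | 0 <= t]].
Proof.
rewrite (_ : [set _ | _ in _] =
    [set (1 - t) *: p + t *: (p + q) | t in [set t : R | 0 <= t]]).
  apply: affine_connected; rewrite (_ : mkset _ = `[0, +oo[%classic); last first.
    by apply/seteqP; split=> t /=; rewrite in_itv /= andbT.
  exact/connected_intervalP/interval_is_interval.
by apply: eq_imagel => t _; rewrite scalerDr scalerBl scale1r addrA subrK.
Qed.

Lemma bounded_set_sub (A B : set (R * R)) : A `<=` B -> bounded_set B -> bounded_set A.
Proof. by move=> AB [M [Mr h]]; exists M; split=> // M' /h {}h x /AB /h. Qed.

Lemma bounded_coords (A : set (R * R)) (M : R) :
  (forall q, A q -> `|q.1| <= M /\ `|q.2| <= M) -> bounded_set A.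
Proof.
move=> AM; exists M; split; first exact: num_real.
move=> M' MM' q /AM[q1 q2]; rewrite /= prod_normE.
by rewrite ge_max !(le_trans _ (ltW MM')).
Qed.

Lemma ray_unbounded p q (A : set (R * R)) : q != 0 ->
  (forall t : R, 0 <= t -> A (p + t *: q)) -> ~ bounded_set A.
Proof.
move=> q0 pA [M [_ /(_ (`|M| + 1))]]; have qn : 0 < `|q| by rewrite normr_gt0.
have MM : M < `|M| + 1 by have := ler_norm M; lra.
move=> /(_ MM) AM; pose t := (`|M| + 2 + `|p|) / `|q|.
have t0 : 0 <= t by apply: divr_ge0 => //; have := normr_ge0 M; have := normr_ge0 p; lra.
have := AM _ (pA t t0) => /=; apply/negP; rewrite -ltNge.
have : `|t *: q| <= `|p + t *: q| + `|p|.
  by have := ler_normB (p + t *: q) p; rewrite [p + _ - p]addrAC subrr add0r.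
rewrite normrZ ger0_norm // /t divfK ?lt0r_neq0 //; lra.
Qed.

(** Within [A] the two closed sets are complementary, so the trace of [K1] is both open and
    closed. *)
Lemma connected_cover (A K1 K2 : set (R * R)) : connected A -> closed K1 -> closed K2 ->
  A `<=` K1 `|` K2 -> A `&` K1 `&` K2 = set0 -> A `&` K1 !=set0 -> A `<=` K1.
Proof.
move=> Ac K1c K2c cov dis ne; suff <- : A `&` K1 = A by move=> q [].
apply: Ac => //; last by exists K1.
exists (~` K2); first exact: closed_openC.
apply/seteqP; split=> q [Aq qK]; split=> //.
  by move=> q2; have : (A `&` K1 `&` K2) q by []; rewrite dis.
by have [] := cov q Aq.
Qed.

Lemma continuous_closed_preimage (h : R * R -> R) (B : set R) :
  continuous h -> closed B -> closed (h @^-1` B).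
Proof. by move=> hc Bc; apply: closed_comp => // q _; exact: hc. Qed.

Definition far_coord (b : bool) (M : R) : set (R * R) :=
  [set q | M <= `|if b then q.1 else q.2| ].

Lemma closed_far_coord (b : bool) (M : R) : closed (far_coord b M).
Proof.
apply: (@continuous_closed_preimage (fun q => `|if b then q.1 else q.2|) [set x | M <= x]).
  move=> q; apply: (@continuous_comp _ _ _ (fun q => if b then q.1 else q.2)).
    by case: b; [exact: cvg_fst|exact: cvg_snd].
  exact: norm_continuous.
exact: closed_ge.
Qed.

End Plane.

Lemma seq_node_in (z : seq node) : exists N, forall u, u \in z -> node_in N u.
Proof.
elim: z => [|u s [N IH]]; first by exists 0.
exists (`|N| + `|u.1.1| + `|u.1.2|) => v; rewrite inE => /predU1P[->|/IH].
  by rewrite /node_in; lia.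
by rewrite /node_in; lia.
Qed.

(** * The interior of the cycle in terms of faces *)

Section NetCycle.
Variables (R : realType) (z : seq node).
Hypothesis hz : net_cycle z.
Implicit Types (q : R * R) (e : eid) (f g : face) (u v : node).

Let cyc : cycle net_edge z. Proof. by case: hz => /andP[]. Qed.

Lemma next_net_edge u : u \in z -> net_edge u (next z u).
Proof. exact: next_cycle. Qed.

Lemma curve_on_edge q : curve z q ->
  exists e, cycle_edge z (ends e true) (ends e false) /\ on_edge false e q.
Proof.
case=> u uz uq; have [b [uE vE]] := eid_ofK (next_net_edge uz).
exists (eid_of u (next z u)); split; last first.
  by apply: (@segment_on_edge _ _ b); rewrite -uE -vE.
have : cycle_edge z u (next z u) by rewrite /cycle_edge uz eqxx.
case: b uE vE => /= <- <- //; by rewrite /cycle_edge orbC.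
Qed.

Lemma cycle_edge_curve e q :
  cycle_edge z (ends e true) (ends e false) -> on_edge false e q -> curve z q.
Proof.
move=> /orP[] /andP[uz /eqP vE] eq; [exists (ends e true)|exists (ends e false)] => //.
  by rewrite -vE; exact: (on_edge_segment true).
by rewrite -vE; exact: (on_edge_segment false).
Qed.

Lemma open_edge_off_curve e q : ~~ cycle_edge z (ends e true) (ends e false) ->
  on_edge true e q -> ~ curve z q.
Proof.
move=> ne eq /curve_on_edge[e' [ce eq']].
by move: ne; rewrite (on_edge_inj eq eq') ce.
Qed.

Lemma vertex_off_curve u : u \notin z -> ~ curve z (pos R u).
Proof.
move=> uz /curve_on_edge[e [ce /on_edge_pos[b uE]]].
move: ce => /orP[] /andP[ez /eqP eE]; move: uz; rewrite uE.
  by case: b {uE}; rewrite ?eE ?mem_next ez.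
by case: b {uE}; rewrite ?eE ?mem_next ez.
Qed.

Lemma connected_interior (A : set (R * R)) p q : connected A -> A `<=` ~` curve z ->
  A p -> A q -> cycle_interior z p -> cycle_interior z q.
Proof.
move=> Ac Az Ap Aq [pz bp]; split; first exact: Az.
apply: bounded_set_sub bp => r qr; apply: connected_component_trans qr.
exact: connected_component_max Aq.
Qed.

(* Faces are convex and their interiors miss the curve. *)
Lemma face_interior f q : closed_face f q -> ~ curve z q ->
  cycle_interior z q <-> cycle_interior z (centre R f).
Proof.
move=> fq qz; have off : segment (centre R f) q `<=` ~` curve z.
  move=> _ [t /= /andP[t0 t1] <-]; move: t1; rewrite le_eqVlt => /predU1P[->|t1].
    by rewrite subrr scale0r add0r scale1r.
  have fo : open_face f ((1 - t) *: centre R f + t *: q).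
    by apply: open_face_star => //; rewrite t0.
  by move=> /curve_on_edge[e [_ /(open_face_edge fo)]].
have c0 : segment (centre R f) q (centre R f).
  by exists 0 => /=; [rewrite lexx ler01|rewrite subr0 scale0r addr0 scale1r].
have q1 : segment (centre R f) q q.
  by exists 1 => /=; [rewrite lexx ler01|rewrite subrr scale0r add0r scale1r].
have sc := @segment_connected_plane R (centre R f) q.
by split; apply: (connected_interior sc).
Qed.

Definition inner : set face := [set f | cycle_interior z (centre R f)].

Definition midpoint e : R * R :=
  (1 - 2^-1) *: pos R (ends e true) + 2^-1 *: pos R (ends e false).

Lemma midpoint_on_edge e : on_edge true e (midpoint e).
Proof. by apply: (@convex_on_edge R true e true); rewrite /lec; lra. Qed.

Lemma ends_on_edge e b : on_edge false e (pos R (ends e b)).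
Proof.
have := @convex_on_edge R false e b 0; rewrite /lec lexx ler01 => /(_ isT isT).
by rewrite subr0 scale1r scale0r addr0.
Qed.

Lemma borders_face_at e : borders (face_at e.1 e.2) e.
Proof. by rewrite /borders eqxx. Qed.

Lemma borders_face_pred e : borders (face_at e.1 (e.2 - 1)) e.
Proof. by rewrite /borders eqxx orbT. Qed.

Lemma cycle_edgeC u v : cycle_edge z u v = cycle_edge z v u.
Proof. by rewrite /cycle_edge orbC. Qed.

Lemma cycle_edge_ends e b :
  cycle_edge z (ends e b) (ends e (~~ b)) = cycle_edge z (ends e true) (ends e false).
Proof. by case: b; rewrite // cycle_edgeC. Qed.

Lemma inner_face_vertex f e b : inner f -> borders f e -> system_vert R z (ends e b).
Proof.
move=> If bf; have [ez|ez] := boolP (ends e b \in z); [by left|right].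
apply/(face_interior _ (vertex_off_curve ez)); last exact: If.
exact: on_edge_closed_face bf (ends_on_edge e b).
Qed.

Lemma inner_face_edge f e b : inner f -> borders f e ->
  edge (C4C8_system R z) (ends e b) (ends e (~~ b)).
Proof.
move=> If bf; split; [exact: net_edge_ends|exact: inner_face_vertex bf..|].
rewrite cycle_edge_ends; have [ce|ce] := boolP (cycle_edge z _ _); [by left|right].
move=> q /open_segment_on_edge eq; have qz := open_edge_off_curve ce eq.
apply/(face_interior _ qz); last exact: If.
exact: on_edge_closed_face bf (on_edgeW eq).
Qed.

Lemma system_edge_inner f e : edge (C4C8_system R z) (ends e true) (ends e false) ->
  ~~ cycle_edge z (ends e true) (ends e false) -> borders f e -> inner f.
Proof.
move=> [_ _ _ [->//|oe]] ce bf; have me := midpoint_on_edge e.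
apply/(face_interior (on_edge_closed_face bf (on_edgeW me)) (open_edge_off_curve ce me)).
by apply: oe; exists 2^-1 => //=; lra.
Qed.

Lemma inner_across e : ~~ cycle_edge z (ends e true) (ends e false) ->
  inner (face_at e.1 e.2) <-> inner (face_at e.1 (e.2 - 1)).
Proof.
move=> ce; have me := midpoint_on_edge e.
have off := open_edge_off_curve ce me; have := on_edgeW me => mc.
have h1 := face_interior (on_edge_closed_face (borders_face_at e) mc) off.
have h2 := face_interior (on_edge_closed_face (borders_face_pred e) mc) off.
by split=> h; [apply/h2/h1|apply/h1/h2].
Qed.

(** Such a vertex is off the curve, so every face around it is inner and brings its edges into the
    system. *)
Lemma net_edge_inside u v : system_vert R z u -> u \notin z -> net_edge u v ->
  edge (C4C8_system R z) u v.
Proof.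
move=> su uz uv; have [b [uE vE]] := eid_ofK uv; set e := eid_of u v in uE vE.
have ce : ~~ cycle_edge z (ends e true) (ends e false).
  rewrite -(cycle_edge_ends e b) -uE -vE /cycle_edge (negbTE uz) /=.
  by apply/negP => /andP[vz /eqP uN]; move: uz; rewrite uN mem_next vz.
have iu : cycle_interior z (pos R u) by case: su => //; rewrite (negbTE uz).
rewrite uE vE; apply: inner_face_edge (borders_face_at e).
apply/(face_interior _ (vertex_off_curve uz)) => //.
by rewrite uE; exact: on_edge_closed_face (borders_face_at e) (ends_on_edge e b).
Qed.

Lemma pos_bound N u : node_in N u ->
  `|(pos R u).1| <= grid R N + 1 /\ `|(pos R u).2| <= grid R N + 1.
Proof.
case: u => [[i j] [a s]] /and4P[/= /(grid_le R) + /(grid_le R) + /(grid_le R) + /(grid_le R)].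
rewrite !gridN /grid => h1 h2 h3 h4; rewrite !ler_norml.
by case: a; case: s; split; lra.
Qed.

Lemma curve_bound N q : (forall u, u \in z -> node_in N u) -> curve z q ->
  `|q.1| <= grid R N + 1 /\ `|q.2| <= grid R N + 1.
Proof.
move=> zN [u uz [t /= /andP[t0 t1] <-]].
have [] := pos_bound (zN u uz); have [] := pos_bound (zN (next z u) _).
  by rewrite mem_next.
move: (pos R u) (pos R (next z u)) (grid R N + 1) => [x y] [x' y'] B /= h1 h2 h3 h4.
have conv (a b : R) : `|a| <= B -> `|b| <= B -> `|(1 - t) * a + t * b| <= B.
  move=> aB bB; apply: le_trans (ler_normD _ _) _; rewrite !normrM.
  rewrite (ger0_norm t0) (ger0_norm (_ : 0 <= 1 - t)) ?subr_ge0 //.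
  have := ler_wpM2l t0 bB; have := @ler_wpM2l _ (1 - t) _ _ _ aB.
  rewrite subr_ge0 => /(_ t1); lra.
by split; exact: conv.
Qed.

(** From a point with a larger coordinate, the ray that increases this coordinate in absolute value
    misses the curve, so the component of the point is unbounded. *)
Lemma interior_bound N q : (forall u, u \in z -> node_in N u) -> cycle_interior z q ->
  `|q.1| <= grid R N + 1 /\ `|q.2| <= grid R N + 1.
Proof.
move=> zN [qz bq].
have B0 : 0 <= grid R N + 1.
  case: hz => _; case: z zN => // u s zN _.
  by have [+ _] := pos_bound (zN u (mem_head _ _)); exact: le_trans.
have far d : d != 0 -> (forall t : R, 0 <= t -> ~ curve z (q + t *: d)) -> False.
  move=> d0 off; apply: (ray_unbounded d0 _ bq) => t t0.
  apply: (connected_component_max _ _ (@ray_connected R q d)); last by exists t.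
    by exists 0; rewrite //= scale0r addr0.
  by move=> _ [s /= s0 <-]; exact: off.
have stretch (a t : R) : 0 <= t -> `|a| <= `|a + t * a|.
  move=> t0; rewrite -{2}[a]mul1r -mulrDl normrM ler_peMl // ger0_norm; lra.
case: q qz bq far => x y /= qz bq far; split; rewrite leNgt; apply/negP => lt.
  apply: (far (x, 0)).
    by apply/eqP => -[x0]; move: lt; rewrite x0 normr0 ltNge B0.
  move=> t t0 /(curve_bound zN)[/= + _]; apply/negP; rewrite -ltNge.
  exact: lt_le_trans lt (stretch _ _ t0).
apply: (far (0, y)).
  by apply/eqP => -[y0]; move: lt; rewrite y0 normr0 ltNge B0.
move=> t t0 /(curve_bound zN)[/= _ +]; apply/negP; rewrite -ltNge.
exact: lt_le_trans lt (stretch _ _ t0).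
Qed.

Lemma system_vert_in N u : (forall v, v \in z -> node_in N v) ->
  system_vert R z u -> node_in N u.
Proof.
have p2 := period_gt2 R => zN [/zN //|/(interior_bound zN)].
case: u => [[i j] [a s]]; rewrite /= -!/(grid R _) !ler_norml => -[h1 h2].
have [x1 x2] : grid R i <= grid R N + 2 /\ - grid R i <= grid R N + 2.
  by move: h1; case: (a); case: (s); lra.
have [y1 y2] : grid R j <= grid R N + 2 /\ - grid R j <= grid R N + 2.
  by move: h2; case: (a); case: (s); lra.
by apply/and4P; split; apply: (@grid_ltS R); rewrite ?gridN; lra.
Qed.

Lemma inner_in N f : (forall v, v \in z -> node_in N v) -> inner f -> face_in N f.
Proof.
have p2 := period_gt2 R => zN /(interior_bound zN).
case: f => [[] [i j]]; rewrite /= !ler_norml => -[h1 h2];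
  by apply/and4P; split; apply: (@grid_ltS R); rewrite ?gridN; lra.
Qed.

(** Let [S'] consist of the faces of [S] that are not inner. Only cycle edges separate [S'] from the
    other faces: across any other edge [inner] is constant, and a change of [S] would make it a
    system edge off the cycle, whose faces are inner. So the union of [S'] and the rest of the plane
    are closed sets that meet only on the curve. The component of the centre of a face of [S'] stays
    in the bounded union, which makes that face inner, a contradiction. *)
Lemma face_set_inner N (S : pred face) : (forall f, S f -> face_in N f) ->
  (forall e, S (face_at e.1 e.2) != S (face_at e.1 (e.2 - 1)) ->
    edge (C4C8_system R z) (ends e true) (ends e false)) ->
  forall f, S f -> inner f.
Proof.
(* The goal is again that [f0] is inner, now with the contrary assumption at hand to put [f0] in
   [S']. *)
move=> SN Sedge f0 Sf0; apply: contrapT => nf0; apply: (nf0).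
pose S' f := S f && ~~ `[< inner f >].
have S'f0 : S' f0 by rewrite /S' Sf0; apply/asboolPn.
have S'across e : ~~ cycle_edge z (ends e true) (ends e false) ->
    S' (face_at e.1 e.2) = S' (face_at e.1 (e.2 - 1)).
  move=> ce; rewrite /S' (asbool_equiv_eq (inner_across ce)).
  have [/asboolP//|nI] := boolP `[< inner (face_at e.1 (e.2 - 1)) >].
    by rewrite !andbF.
  rewrite !andbT; apply/eqP; apply: contraNT nI => /Sedge ee.
  by apply/asboolP; exact: system_edge_inner ee ce (borders_face_pred e).
(* Faces with indices up to [N + 2] cover the open box of half-width [M], and by [closed_face_bound]
   the faces of [S] stay inside it. *)
have [fs fsP] := face_in_finite (N + 2).
pose M := grid R (N + 2).
pose K1 : set (R * R) := \big[setU/set0]_(f <- fs | S' f) closed_face f.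
pose K2 : set (R * R) := \big[setU/set0]_(f <- fs | ~~ S' f) closed_face f `|`
  (far_coord true M `|` far_coord false M).
have K1c : closed K1.
  by rewrite /K1 -big_filter; apply: closed_bigsetU => f _; exact: closed_face_closed.
have K2c : closed K2.
  apply: closedU; last by apply: closedU; exact: closed_far_coord.
  by rewrite -big_filter; apply: closed_bigsetU => f _; exact: closed_face_closed.
have K1P q : K1 q -> exists2 f, S' f & closed_face f q.
  by rewrite /K1 -bigcup_seq_cond => -[f /= /andP[_ S'f] fq]; exists f.
have K1bound q : K1 q -> (- M < q.1 < M) /\ (- M < q.2 < M).
  by move=> /K1P[f /andP[/SN fN _] fq]; exact: closed_face_bound fq.
have cov q : K1 q \/ K2 q.
  have [x1|x1] := leP M `|q.1|; first by right; right; left.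
  have [y1|y1] := leP M `|q.2|; first by right; right; right.
  have [f fN fq] : exists2 f, face_in (N + 2) f & closed_face f q.
    by apply: closed_faces_cover; rewrite -ltr_norml.
  have [S'f|S'f] := boolP (S' f); [left|right; left].
    by rewrite /K1 -bigcup_seq_cond; exists f => //=; rewrite fsP.
  by rewrite -bigcup_seq_cond; exists f => //=; rewrite fsP.
have dis q : K1 q -> K2 q -> curve z q.
  move=> K1q; have [f S'f fq] := K1P q K1q; have [qx qy] := K1bound q K1q.
  case=> [|[|]]; last 2 first.
  - by rewrite /far_coord /= leNgt ltr_norml qx.
  - by rewrite /far_coord /= leNgt ltr_norml qy.
  rewrite -bigcup_seq_cond => -[g /= /andP[_ S'g] gq].
  have fg : f != g by apply: contraNneq S'g => <-.
  have [e sep eq] := closed_faces_meet fg fq gq; apply: (cycle_edge_curve _ eq).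
  apply: contraNT S'g => /S'across; case: sep => -[-> ->]; by rewrite S'f.
have c0 : ~ curve z (centre R f0).
  by move=> /curve_on_edge[e [_ /(open_face_edge (centre_open _ _))]].
have f0K1 : K1 (centre R f0).
  rewrite /K1 -bigcup_seq_cond; exists f0 => /=; last first.
    apply/allP => h hf; apply: ltW; exact: (allP (centre_open R f0)) hf.
  by rewrite S'f0 fsP //; have /andP[/SN] := S'f0; rewrite /face_in; lia.
split=> //; apply: (@bounded_coords R _ M) => q.
have sub : connected_component (~` curve z) (centre R f0) `<=` K1.
  apply: (connected_cover (@component_connected _ _ _) K1c K2c).
  - by move=> p _; exact: cov.
  - by apply/seteqP; split=> // p [[/connected_component_sub pz K1p] /(dis _ K1p)].
  - by exists (centre R f0); split=> //; exact: connected_component_refl.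
by move=> /sub /K1bound[qx qy]; rewrite !ltW // ltr_norml.
Qed.

End NetCycle.

(** * Enclosed faces and connectedness of the system, and the theorem *)

Section System.
Variables (R : realType) (z : seq node).
Hypothesis hz : net_cycle z.
Let G := C4C8_system R z.

Lemma path_eids_edge u p e : path (adj G) u p -> e \in eids u p ->
  edge G (ends e true) (ends e false).
Proof.
elim: p u => //= v p IH u /andP[/asboolP uv /IH {}IH]; rewrite inE => /predU1P[->|/IH //].
have [b [uE vE]] := eid_ofK (let: And4 h _ _ _ := uv in h).
by case: b uE vE => /= <- <- //; exact: (@edge_sym _ G u v).
Qed.

(** By [enclosed_boundary], an edge across which [enclosed] changes occurs in one of the walks,
    hence in the system; this is the hypothesis of [face_set_inner]. *)
Lemma enclosed_inner N u p q : (forall v, v \in z -> node_in N v) ->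
  path (adj G) u p -> path (adj G) u q -> last u p = last u q ->
  forall f, enclosed (eids u p ++ eids u q) f -> inner R z f.
Proof.
move=> zN pp pq lpq; set W := _ ++ _.
have Wedge e : e \in W -> edge G (ends e true) (ends e false).
  by rewrite mem_cat => /orP[]; exact: path_eids_edge.
have net v s : path (adj G) v s -> path net_edge v s.
  by apply: sub_path => x y /asboolP[].
have bal : balanced W by exact: balanced_paths (net _ _ pp) (net _ _ pq) lpq.
apply: (face_set_inner hz (N := N)).
  move=> f; apply: enclosed_in => // e /Wedge ee.
  by apply: (system_vert_in hz zN); exact: edge_vert (edge_sym ee).
move=> e; rewrite negb_eqb addbC enclosed_boundary // -surjective_pairing.
by move=> /par_mem[e' /Wedge + /eqP <-].
Qed.

Lemma cycle_adj : cycle (adj G) z.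
Proof.
case: (hz) => /andP[cyc uz] _; apply: cycle_from_next => // u uz'.
apply/asboolP; split; [exact: next_cycle|by left| |by left; rewrite /cycle_edge uz' eqxx].
by left; rewrite mem_next.
Qed.

Lemma cycle_connected u v : u \in z -> v \in z ->
  exists p, path (adj G) u p /\ last u p = v.
Proof.
move=> uz vz; have [i s zE] := rot_to uz.
have := cycle_adj; rewrite -(rot_cycle i) zE /= => us.
move: vz; rewrite -(mem_rot i) zE inE => /predU1P[->|vs]; first by exists [::].
case/splitPr: vs us => s1 s2; rewrite rcons_cat cat_path /= => /and3P[p1 v1 _].
by exists (rcons s1 v); rewrite rcons_path p1 v1 last_rcons.
Qed.

Definition east (u : node) : node :=
  let: ((i, j), (a, s)) := u in
  if a then ((i, j), (false, true))
  else if s then ((i + 1, j), (false, false)) else ((i, j), (true, true)).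

Lemma net_edge_east u : net_edge u (east u).
Proof.
case: u => [[i j] [[] []]]; rewrite /net_edge !linkE /square_edge /= ?xpair_eqE; lia.
Qed.

(** Counts the steps of [east] left before the walk leaves the box; passing from one square to the
    next takes three. *)
Definition east_rank (N : int) (u : node) : int :=
  let: ((i, _), (a, s)) := u in (N - i) * 3 + (if a then 1 else if s then 0 else 2).

Lemma east_rankS N u : east_rank N (east u) = east_rank N u - 1.
Proof. by case: u => [[i j] [[] []]] /=; lia. Qed.

(** A vertex off the cycle keeps its edge to the east, and the walk east must reach the cycle
    because [east_rank] decreases and is nonnegative on the system. *)
Lemma reach_cycle u : vert G u ->
  exists2 v, v \in z & exists p, path (adj G) u p /\ last u p = v.
Proof.
have [N zN] := seq_node_in z.
have rank0 w : vert G w -> 0 <= east_rank N w.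
  move=> /(system_vert_in hz zN); case: w => [[i j] [a s]] /and4P[_ /= iN _ _].
  by case: a; case: s; lia.
have [n] := ubnP `|east_rank N u|%N; elim: n u => // n IH u un Gu.
have [uz|uz] := boolP (u \in z); first by exists u => //; exists [::].
have ue := net_edge_inside hz Gu uz (net_edge_east u).
have Ge : vert G (east u) by exact: edge_vert (edge_sym ue).
have [|v vz [p [pp lp]]] := IH (east u) _ Ge.
  by have := rank0 _ Ge; have := rank0 _ Gu; rewrite east_rankS; lia.
by exists v => //; exists (east u :: p); rewrite /= pp lp andbT; split=> //; exact/asboolP.
Qed.

Lemma system_connected u v : vert G u -> vert G v ->
  exists p, path (adj G) u p /\ last u p = v.
Proof.
move=> /reach_cycle[a az [p [pp lp]]] /reach_cycle[b bz [q [pq lq]]].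
have [r [pr lr]] := cycle_connected az bz.
have [q' [pq' lq' _]] := rev_path_labels (lab := fun _ _ => tt) (fun _ _ _ => erefl) pq.
exists (p ++ r ++ q'); rewrite !cat_path pp lp pr lr !last_cat lp lr -lq pq'.
by rewrite lq'.
Qed.

End System.

Theorem theorem4p1 (R : realType) (z : seq node) (hz : net_cycle z) :
  partial_cube (C4C8_system R z).
Proof.
have [N zN] := seq_node_in z.
have [u uz] : exists u, u \in z.
  by case: hz => _; case: (z) => // u s _; exists u; exact: mem_head.
apply: (@inner_faces_partial_cube _ (inner R z) N _ _ _ _ _ u).
- by move=> v w [].
- by move=> f e b; exact: inner_face_edge.
- by move=> f; exact: (inner_in hz zN).
- by move=> v p q; exact: (enclosed_inner hz zN).
- by move=> v; exact: (system_vert_in hz zN).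
- by left.
- exact: (system_connected hz).
Qed.
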